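(* Let $0<R<1$, $\Delta_V<\Delta_C$ positive integers with $\Delta_V/\Delta_C=1-R$, and parameters $1\le\alpha<A$, $\frac1{1-R}<\beta<\min\{\frac2{1-R},B\}$, $0<\epsilon<(1-R)/A$, $0<\vartheta<1/(B(1-R))$, such that $\Delta_V$ satisfies the degree condition $(\star)$ below. Suppose that for each $n$ the graph $\mathcal G=\mathcal G^{(n)}$ is an $(\alpha,A,\beta,B,\epsilon,\vartheta)$-good $(\Delta_V,\Delta_C)$-regular bipartite graph. If \[ \lambda>\max\Big\{\frac{1}{2(1-R)},\ \frac{2B+3/2}{B(1-R)-1}\Big\}, \] then the dual $\Lambda^*$ of a randomly chosen lattice $\Lambda$ from the $(\mathcal G,\lambda)$ LDA ensemble is good for packing with probability tending to $1$ as $n\to\infty$.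
   Context: $\mathcal G$ has $n$ variable nodes and $n(1-R)$ check nodes; $N(S)$ denotes neighbourhood. It is $(\alpha,A,\beta,B,\epsilon,\vartheta)$-good if: (L1) variable-node sets $S$ with $|S|\le\lceil\epsilon n\rceil$ have $|N(S)|\ge A|S|$; (L2) variable-node sets $S$ with $|S|\le\lceil n(1-R)/(2\alpha)\rceil$ have $|N(S)|\ge\alpha|S|$; (R1) check-node sets $T$ with $|T|\le\vartheta n(1-R)$ have $|N(T)|\ge B|T|$; (R2) check-node sets $T$ with $|T|\le n(1-R)/2$ have $|N(T)|\ge\beta|T|$. Degree condition $(\star)$, with $h_2(a)=-a\log_2a-(1-a)\log_2(1-a)$: $\Delta_V>\max\Big\{\frac{h_2(\frac{1-R}{2\alpha})+1-R}{h_2(\frac{1-R}{2\alpha})-\frac12h_2(\frac{1-R}{\alpha})},\ R+2\alpha,\ A+1,\ \frac{h_2(\epsilon)+(1-R)h_2(\frac{A\epsilon}{1-R})}{h_2(\epsilon)-\frac{A\epsilon}{1-R}h_2(\frac{1-R}{A})},\ \frac{1-R+h_2(\frac{\beta(1-R)}{2})}{1-\frac{\beta(1-R)}{2}h_2(\frac{1}{\beta(1-R)})},\ \frac{(2+\beta R)(1-R)}{2-\beta(1-R)},\ (1-R)(B+1),\ \frac{(1-R)h_2(\vartheta)+h_2(B\vartheta(1-R))}{h_2(\vartheta)-B\vartheta(1-R)h_2(\frac{1}{B(1-R)})},\ \frac{(A+1)(1-R)-A\epsilon(2-R)}{1-R-A\epsilon},\ \frac{B+1-\vartheta B(2-R)}{\frac1{1-R}-\vartheta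 B}\Big\}$. $(\mathcal G,\lambda)$ LDA ensemble: $p$ is the smallest prime $\ge n^\lambda$; $\widehat H$ is the $n(1-R)\times n$ $0/1$ biadjacency matrix of $\mathcal G$; $H$ has entries $\widehat h_{i,j}h'_{i,j}$ with $h'_{i,j}$ i.i.d. uniform on $\mathbb F_p$; $\Lambda=\{\mathbf x\in\mathbb Z^n:H(\mathbf x\bmod p)=\mathbf 0\text{ over }\mathbb F_p\}$. The dual lattice is $\Lambda^*=\{\mathbf y\in\mathbb R^n:\mathbf x^T\mathbf y\in\mathbb Z\ \forall\mathbf x\in\Lambda\}$. Packing goodness: with $r_{\rm pack}$ the radius of the largest open ball inside the fundamental Voronoi region and $r_{\rm eff}$ the radius of a ball with the same volume as that region, a sequence of lattices $\{\Lambda^{(n)}\}$ is good for packing if $\limsup_n r_{\rm pack}(\Lambda^{(n)})/r_{\rm eff}(\Lambda^{(n)})\ge1/2$. *)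

(* Defs.v *)
From HB Require Import structures.
From mathcomp Require Import all_boot all_order all_algebra.
From mathcomp Require Import all_classical all_reals all_analysis.
Set Implicit Arguments. Unset Strict Implicit. Unset Printing Implicit Defensive.
Import Order.TTheory GRing.Theory Num.Theory.
Local Open Scope classical_set_scope.
Local Open Scope ring_scope.

Section Defs.
Variable F : realType.

Definition h2 (a : F) : F :=
  - a * (ln a / ln 2) - (1 - a) * (ln (1 - a) / ln 2).

(** Bipartite graph: n variable nodes 'I_n, m check nodes 'I_m,
    G i j = true iff check node i is adjacent to variable node j. *)
Definition nbV m n (G : 'I_m -> 'I_n -> bool) (S : {set 'I_n}) : {set 'I_m} :=
  [set i | [exists j in S, G i j]].
Definition nbC m n (G : 'I_m -> 'I_n -> bool) (T : {set 'I_m}) : {set 'I_n} :=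
  [set j | [exists i in T, G i j]].

Definition biregular m n (G : 'I_m -> 'I_n -> bool) (dV dC : nat) : Prop :=
  (forall j : 'I_n, #|[set i | G i j]| = dV) /\
  (forall i : 'I_m, #|[set j | G i j]| = dC).

Definition good m n (G : 'I_m -> 'I_n -> bool) (R al A be B eps th : F) : Prop :=
  [/\ (forall S : {set 'I_n}, (#|S|%:Z <= Num.ceil (eps * n%:R))%R ->
         A * #|S|%:R <= #|nbV G S|%:R),
      (forall S : {set 'I_n},
         (#|S|%:Z <= Num.ceil (n%:R * (1 - R) / (2 * al)))%R ->
         al * #|S|%:R <= #|nbV G S|%:R),
      (forall T : {set 'I_m}, #|T|%:R <= th * n%:R * (1 - R) ->
         B * #|T|%:R <= #|nbC G T|%:R) &
      (forall T : {set 'I_m}, #|T|%:R <= n%:R * (1 - R) / 2 ->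
         be * #|T|%:R <= #|nbC G T|%:R)].

Definition degree_condition (dV : F) (R al A be B eps th : F) : Prop :=
  [/\ (h2 ((1 - R) / (2 * al)) + 1 - R) /
        (h2 ((1 - R) / (2 * al)) - 2^-1 * h2 ((1 - R) / al)) < dV,
      R + 2 * al < dV,
      A + 1 < dV &
      (h2 eps + (1 - R) * h2 (A * eps / (1 - R))) /
        (h2 eps - A * eps / (1 - R) * h2 ((1 - R) / A)) < dV] /\
  [/\ (1 - R + h2 (be * (1 - R) / 2)) /
        (1 - be * (1 - R) / 2 * h2 (1 / (be * (1 - R)))) < dV,
      (2 + be * R) * (1 - R) / (2 - be * (1 - R)) < dV &
      (1 - R) * (B + 1) < dV] /\
  [/\ ((1 - R) * h2 th + h2 (B * th * (1 - R))) /
        (h2 th - B * th * (1 - R) * h2 (1 / (B * (1 - R)))) < dV,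
      ((A + 1) * (1 - R) - A * eps * (2 - R)) / (1 - R - A * eps) < dV &
      (B + 1 - th * B * (2 - R)) / ((1 - R)^-1 - th * B) < dV].

Definition smallest_prime_ge (p : nat) (x : F) : Prop :=
  [/\ prime p, x <= p%:R & forall q : nat, prime q -> x <= q%:R -> (p <= q)%N].

(** The lattice of the LDA ensemble: Ghat is the 0/1 biadjacency matrix,
    h the i.i.d. uniform multipliers; H_{ij} = Ghat_{ij} h_{ij}. *)
Definition LDA_lattice m n (p : nat) (G : 'I_m -> 'I_n -> bool)
    (h : {ffun 'I_m * 'I_n -> 'F_p}) : set ('I_n -> int) :=
  [set x | forall i : 'I_m,
     \sum_(j < n) ((G i j)%:R * h (i, j)) * (x j)%:~R = 0 :> 'F_p].

Definition dotp n (x y : 'I_n -> F) : F := \sum_(i < n) x i * y i.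
Definition enorm n (y : 'I_n -> F) : F := Num.sqrt (dotp y y).

Definition dual_lattice n (L : set ('I_n -> int)) : set ('I_n -> F) :=
  [set y | forall x, L x -> exists z : int, dotp (fun i => (x i)%:~R) y = z%:~R].

Definition voronoi n (L : set ('I_n -> F)) : set ('I_n -> F) :=
  [set y | forall l, L l -> enorm y <= enorm (fun i => y i - l i)].

Definition open_ball0 n (r : F) : set ('I_n -> F) := [set y | enorm y < r].

Definition box n (a b : 'I_n -> F) : set ('I_n -> F) :=
  [set y | forall i, a i <= y i < b i].
Definition leb_vol n (A : set ('I_n -> F)) : \bar F :=
  ereal_inf [set s : \bar F | exists a b : nat -> 'I_n -> F,
    [/\ forall k i, a k i <= b k i,
        A `<=` \bigcup_k box (a k) (b k) &
        s = (\sum_(0 <= k <oo) (\prod_(i < n) (b k i - a k i))%:E)%E]].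

Definition r_pack n (L : set ('I_n -> F)) : F :=
  sup [set r : F | 0 <= r /\ @open_ball0 n r `<=` voronoi L].

Definition r_eff n (L : set ('I_n -> F)) : F :=
  xget 0 [set r : F | 0 <= r /\ leb_vol (@open_ball0 n r) = leb_vol (voronoi L)].

Definition prob_unif m n p (P : {ffun 'I_m * 'I_n -> 'F_p} -> Prop) : F :=
  #|[set h : {ffun 'I_m * 'I_n -> 'F_p} | `[< P h >] ]|%:R /
  #|{: {ffun 'I_m * 'I_n -> 'F_p}}|%:R.

End Defs.

(* Main.v *)
(* Up to the factor 1/p, the dual lattice is the set of integer vectors whose
   residue mod p lies in the row space of H, and its minimum distance is twice
   the packing radius.  Let rho be the radius of a ball of volume p^-m; then
   r_eff <= rho as soon as H has full row rank, so it is enough that with high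
   probability no combination u H (u <> 0) has an integer lift shorter than
   r = (1 - d) p rho; since the zero vector is short, this event also forces H
   to have full rank, and r <= p takes care of the lifts of 0.  If u has support
   T, then u H is uniform on the vectors supported in N(T), so the union bound
   leaves the sum over T <> 0 of p^|T| p^-|N(T)| #{short vectors supported in N(T)}.
   For |T| <= m / 2 a Chernoff bound on the number of short vectors and the
   expansions (R1), (R2) make the terms geometrically small.  For |T| > m / 2,
   (L2) gives n - |N(T)| <= m - |T|; comparing the short vectors, thickened in the
   missing coordinates, with the volume of a ball bounds the term by
   theta^n (1/(kappa p^R))^(m - |T|) with theta < 1. *)
Require Import Defs.
From HB Require Import structures.
From mathcomp Require Import all_boot all_order all_algebra.
From mathcomp Require Import all_classical all_reals all_analysis.
From mathcomp Require Import measurable_realfun ring lra zify.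
Set Implicit Arguments. Unset Strict Implicit.
Import Order.TTheory GRing.Theory Num.Theory numFieldNormedType.Exports.
Local Open Scope classical_set_scope.
Local Open Scope ring_scope.

(** * Volume *)

Lemma leb_vol_ge0 (F : realType) n (A : set ('I_n -> F)) : (0 <= leb_vol A)%E.
Proof.
apply: le_ereal_inf_tmp => _ [a [b [ab _ ->]]].
by apply: nneseries_ge0 => k _ _; rewrite lee_fin prodr_ge0// => i _; rewrite subr_ge0.
Qed.

Lemma le_leb_vol (F : realType) n (A B : set ('I_n -> F)) :
  A `<=` B -> (leb_vol A <= leb_vol B)%E.
Proof.
move=> AB; apply: ereal_inf_le_tmp => s [a [b [ab Bab ->]]].
by exists a, b; split => //; apply: subset_trans Bab.
Qed.

Lemma leb_vol_le_cover (F : realType) n (I : finType) (D : {set I})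
    (a b : I -> 'I_n -> F) (A : set ('I_n -> F)) :
  (0 < n)%N -> (forall x i, a x i <= b x i) ->
  (forall y, A y -> exists2 x, x \in D & box (a x) (b x) y) ->
  (leb_vol A <= (\sum_(x in D) \prod_i (b x i - a x i))%:E)%E.
Proof.
move=> n0 ab Acov.
pose s := [seq Some x | x <- enum D].
(* Past the end of the list all sides are 0; such boxes are empty, and their volume is 0 because
   [0 < n]. *)
pose a' k := if nth None s k is Some x then a x else fun=> 0.
pose b' k := if nth None s k is Some x then b x else fun=> 0.
apply: ereal_inf_lbound; exists a', b'; split.
- by move=> k i; rewrite /a' /b'; case: nth.
- move=> y /Acov[x xD yx]; exists (index x (enum D)) => //.
  rewrite /a' /b' (nth_map x) ?index_mem ?mem_enum//.
  by rewrite nth_index ?mem_enum.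
- rewrite (@nneseries_split _ _ 0 (size s)) //; last first.
    move=> k _; rewrite lee_fin prodr_ge0// => i _; rewrite subr_ge0.
    by rewrite /a' /b'; case: nth.
  rewrite [X in (_ + X)%E]eseries0 ?adde0; last first.
    move=> k /= + _; rewrite add0n => ks.
    by rewrite /a' /b' nth_default// (bigD1 (Ordinal n0))//= subrr mul0r.
  rewrite add0n sumEFin; congr EFin.
  rewrite -[in LHS]big_enum /=.
  have -> : \sum_(i <- enum D) \prod_i0 (b i i0 - a i i0) =
     \sum_(x <- s) if x is Some i then \prod_i0 (b i i0 - a i i0) else 0.
    by rewrite big_map.
  rewrite (big_nth None) big_nat [RHS]big_nat; apply: eq_bigr => k /andP[_ ks].
  rewrite /a' /b'; case: nth => //.
  by rewrite (bigD1 (Ordinal n0))//= subrr mul0r.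
Qed.

Lemma leb_vol_scale_le (F : realType) n (A : set ('I_n -> F)) (c : F) : 0 < c ->
  (leb_vol [set y | A (fun i => (c^-1 * y i)%R)] <= (c ^+ n)%:E * leb_vol A)%E.
Proof.
move=> c0; rewrite -lee_pdivrMl ?exprn_gt0//.
apply: le_ereal_inf_tmp => _ [a [b [ab Acov ->]]].
rewrite lee_pdivrMl ?exprn_gt0// -nneseriesZl; last first.
  by move=> k _; rewrite lee_fin prodr_ge0// => i _; rewrite subr_ge0.
apply: ereal_inf_lbound; exists (fun k i => c * a k i), (fun k i => c * b k i); split.
- by move=> k i; rewrite ler_pM2l.
- move=> y /Acov[k _ yk]; exists k => // i.
  have /andP[h1 h2] := yk i.
  by rewrite -ler_pdivlMl// h1 -ltr_pdivrMl.
- apply: eq_eseriesr => k _; rewrite -EFinM; congr EFin.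
  under [RHS]eq_bigr do rewrite -mulrBr.
  by rewrite big_split /= prodr_const card_ord.
Qed.

Lemma leb_vol_scale (F : realType) n (A : set ('I_n -> F)) (c : F) : 0 < c ->
  leb_vol [set y | A (fun i => c^-1 * y i)] = ((c ^+ n)%:E * leb_vol A)%E.
Proof.
move=> c0; apply/eqP; rewrite eq_le leb_vol_scale_le//=.
(* The converse is the same inequality for the scaled set and the factor [c^-1]. *)
rewrite -lee_pdivlMl ?exprn_gt0// -exprVn.
have ci0 : 0 < c^-1 by rewrite invr_gt0.
apply: le_trans (leb_vol_scale_le _ ci0).
apply: le_leb_vol => y /= Ay; congr (A _) : Ay.
by apply/funext => i; rewrite invrK mulrA mulVf ?gt_eqF// mul1r.
Qed.

(* Fubini one coordinate at a time: an inequality between sums of indicators of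
   boxes survives replacing, coordinate after coordinate, each indicator of a
   side by the length of that side. *)
Lemma leb_vol_ge_packing (F : realType) n (I : finType) (D : {set I})
    (a b : I -> 'I_n -> F) (A : set ('I_n -> F)) :
  (forall x i, a x i <= b x i) ->
  (forall x, x \in D -> box (a x) (b x) `<=` A) ->
  (forall x x' y, x \in D -> x' \in D -> box (a x) (b x) y ->
     box (a x') (b x') y -> x = x') ->
  ((\sum_(x in D) \prod_i (b x i - a x i))%:E <= leb_vol A)%E.
Proof.
move=> ab DA Ddis; apply: le_ereal_inf_tmp => _ [a' [b' [ab' Acov ->]]].
(* [W j] has the first [j] coordinates integrated out: [W 0] is the indicator of the box, [W n] its
   volume. *)
pose W (j : nat) (a b y : 'I_n -> F) : F :=
  \prod_(i < n) (if (i < j)%N then b i - a i else (a i <= y i < b i)%R%:R).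
have W0 j u v y : (forall i, u i <= v i) -> 0 <= W j u v y.
  by move=> uv; apply: prodr_ge0 => i _; case: ifP; rewrite ?subr_ge0.
suff main j z : (j <= n)%N -> ((\sum_(x in D) W j (a x) (b x) z)%:E <=
    \sum_(0 <= k <oo) (W j (a' k) (b' k) z)%:E)%E.
  have Wn u v : W n u v (fun=> 0) = \prod_i (v i - u i).
    by apply: eq_bigr => i _; rewrite ltn_ord.
  have := main n (fun=> 0) (leqnn n).
  under eq_bigr do rewrite Wn.
  by under eq_eseriesr do rewrite Wn.
have Wbox u v y : W 0%N u v y = `[< box u v y >]%:R.
  rewrite /W; case: (asboolP (box u v y)) => [h|h].
    by rewrite big1// => i _ /=; rewrite h.
  have /existsNP[i /negP hi] := h.
  by rewrite (bigD1 i)//= (negbTE hi) mul0r.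
elim: j z => [|j IH] y jn.
  (* By disjointness at most one term on the left is 1, and then some box of the cover contains the
     point. *)
  under eq_bigr do rewrite Wbox.
  have [[x0 x0D yx0]|no] := pselect (exists2 x, x \in D & box (a x) (b x) y); last first.
    rewrite big1 ?nneseries_ge0//; first by move=> k _ _; rewrite lee_fin W0.
    by move=> x xD; case: asboolP => // yx; case: no; exists x.
  rewrite (bigD1 x0)//= big1 ?addr0; last first.
    move=> x /andP[xD xx0]; case: asboolP => // yx.
    by rewrite (Ddis x x0 y)// eqxx in xx0.
  rewrite asboolT//.
  have [k _ yk] := Acov _ (DA _ x0D _ yx0).
  have -> : 1%:R%:E = (W 0%N (a' k) (b' k) y)%:E by rewrite Wbox asboolT.
  rewrite (@nneseriesD1 _ _ k)//; last by move=> ? _; rewrite lee_fin W0.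
  by rewrite leeDl// nneseries_ge0// => ? _ _; rewrite lee_fin W0.
pose jo := Ordinal jn.
pose yt (t : F) i := if i == jo then t else y i.
(* [E] gathers the factors other than the [j]-th. It is constant along that coordinate, so
   integrating the induction hypothesis over [t] turns each [W j] into [W j.+1]. *)
pose E (u v : 'I_n -> F) := \prod_(i < n | i != jo)
  (if (i < j.+1)%N then v i - u i else (u i <= y i < v i)%R%:R).
have E0 u v : (forall i, u i <= v i) -> 0 <= E u v.
  by move=> uv; apply: prodr_ge0 => i _; case: ifP; rewrite ?subr_ge0.
have WS u v : W j.+1 u v y = E u v * (v jo - u jo).
  by rewrite /W (bigD1 jo)//= ltnSn mulrC.
have Wj u v t : W j u v (yt t) = E u v * \1_(`[u jo, v jo[ : set F) t.
  rewrite /W (bigD1 jo)//= ltnn /yt eqxx mulrC; congr (_ * _).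
    apply: eq_bigr => i ij; rewrite (negbTE ij) ltnS [in RHS]leq_eqVlt.
    by have -> : (i == j :> nat) = false by apply: negbTE.
  by rewrite indicE; congr (nat_of_bool _)%:R; apply/idP/idP; rewrite inE/= in_itv.
pose mu := @lebesgue_measure F.
pose f u v (t : measurableTypeR F) : \bar F :=
  (E u v * \1_(`[u jo, v jo[ : set F) t)%:E.
have mf u v : measurable_fun setT (f u v).
  by apply/measurable_EFinP; apply: measurable_funM.
have if_ u v : (forall i, u i <= v i) -> (\int[mu]_t f u v t)%E = (W j.+1 u v y)%:E.
  move=> uv; rewrite /f; under eq_integral do rewrite EFinM.
  rewrite ge0_integralZl_EFin//; last 2 first.
  - by apply/measurable_EFinP.
  - exact: E0.
  rewrite integral_indic// setIT.
  rewrite [X in (_ * X)%E](lebesgue_measure_itv `[u jo, v jo[) /= lte_fin WS EFinM.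
  by congr (_ * _)%E; have [//|/(conj (uv jo))/andP/le_anti->] := ltP; rewrite subrr.
have f0 u v t : (forall i, u i <= v i) -> (0 <= f u v t)%E.
  by move=> uv; rewrite lee_fin mulr_ge0 ?E0.
have : (\int[mu]_t (\sum_(x <- enum D) f (a x) (b x) t)
   <= \int[mu]_t \sum_(0 <= k <oo) f (a' k) (b' k) t)%E.
  apply: ge0_le_integral => //.
  - by move=> t _; apply: sume_ge0 => x _; apply: f0.
  - by apply: emeasurable_sum => x; exact: mf.
  - apply: ge0_emeasurable_sum => [k t _ _|k _]; [exact: f0|exact: mf].
  - move=> t _; have := IH (yt t) (ltnW jn).
    rewrite -sumEFin big_enum /=; under eq_bigr do rewrite Wj.
    by under eq_eseriesr do rewrite Wj.
rewrite ge0_integral_sum//; last by move=> x t _; apply: f0.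
rewrite integral_nneseries//; last by move=> k t _; apply: f0.
under eq_bigr do rewrite if_//.
under eq_eseriesr do rewrite if_//.
by rewrite sumEFin big_enum.
Qed.

Lemma sqr_enorm (F : realType) n (y : 'I_n -> F) : enorm y ^+ 2 = \sum_i y i ^+ 2.
Proof. by rewrite /enorm sqr_sqrtr ?sumr_ge0// => i _; rewrite -expr2 sqr_ge0. Qed.

Lemma enorm_ge0 (F : realType) n (y : 'I_n -> F) : 0 <= enorm y.
Proof. exact: sqrtr_ge0. Qed.

Lemma open_ball0E (F : realType) n (r : F) : 0 <= r ->
  @open_ball0 F n r = [set y | \sum_i y i ^+ 2 < r ^+ 2].
Proof.
move=> r0; apply/seteqP; split => y; rewrite /open_ball0 /= -sqr_enorm;
  by rewrite ltr_sqr ?nnegrE ?enorm_ge0.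
Qed.

Lemma leb_vol_ball (F : realType) n (r : F) : 0 < r ->
  leb_vol (@open_ball0 F n r) = ((r ^+ n)%:E * leb_vol (@open_ball0 F n 1))%E.
Proof.
move=> r0; rewrite -leb_vol_scale//; congr leb_vol.
have E (y : 'I_n -> F) : \sum_i (r^-1 * y i) ^+ 2 = r ^- 2 * \sum_i y i ^+ 2.
  by rewrite mulr_sumr; apply: eq_bigr => i _; rewrite exprMn exprVn.
rewrite !open_ball0E ?ler01 ?ltW//; apply/seteqP; split => y /=;
  by rewrite E ltr_pdivrMl ?exprn_gt0// expr1n mulr1.
Qed.

(** * Short vectors of residues *)

(** The representative of least absolute value, in [(-p/2, p/2]]. *)
Definition centered_lift p (c : 'F_p) : int :=
  if (2 * c <= p)%N then (c : nat)%:Z else (c : nat)%:Z - p%:Z.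

Lemma intr_Fp_eq0 p (z : int) : prime p -> (z%:~R == 0 :> 'F_p) = (p %| `|z|)%N.
Proof.
move=> pp; rewrite (dvdn_pcharf (pchar_Fp pp)).
by case: (intP z) => [|k|k]; rewrite ?absz0 ?abszN ?absz_nat ?mulrNz ?oppr_eq0 -?pmulrn.
Qed.

Lemma Fp_ltn p (c : 'F_p) : prime p -> (c < p)%N.
Proof. by move=> pp; have := ltn_ord c; rewrite [X in (_ < X)%N -> _]Fp_cast. Qed.

Lemma intr_centered_lift p (c : 'F_p) : prime p -> (centered_lift c)%:~R = c.
Proof.
move=> pp; have cE : (c : nat)%:R = c by rewrite natr_Zp.
by rewrite /centered_lift; case: ifP => _; rewrite ?rmorphB /= -?pmulrn ?pchar_Fp_0 ?subr0.
Qed.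

Lemma centered_lift0 p : centered_lift (0 : 'F_p) = 0.
Proof. by []. Qed.

Lemma centered_lift_le_half p (c : 'F_p) : prime p -> (2 * `|centered_lift c| <= p)%N.
Proof. by move=> pp; have := Fp_ltn c pp; rewrite /centered_lift; case: ifP; lia. Qed.

Lemma centered_lift_small p (z : int) : prime p -> (2 * `|z| < p)%N -> centered_lift (z%:~R : 'F_p) = z.
Proof.
move=> pp zp; have cp := centered_lift_le_half (z%:~R : 'F_p) pp.
set l := centered_lift _ in cp *.
have : (p %| `|l - z|)%N by rewrite -intr_Fp_eq0// rmorphB /= intr_centered_lift// subrr.
have [/eqP|ne /dvdn_leq le_p] := eqVneq (l - z) 0; first by rewrite subr_eq0 => /eqP.
have /le_p : (0 < `|l - z|)%N by rewrite absz_gt0.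
move: l cp zp {ne le_p} => l; lia.
Qed.

Lemma centered_lift_min p (z : int) : prime p -> (`|centered_lift (z%:~R : 'F_p)| <= `|z|)%N.
Proof.
move=> pp; have [/(centered_lift_small pp)->//|zp] := ltnP (2 * `|z|) p.
have := centered_lift_le_half (z%:~R : 'F_p) pp; lia.
Qed.

(** An absolute value [k] can come only from the residues [k] and [p - k], hence the factor 2. *)
Lemma sum_centered_lift_le (F : realType) p (f : nat -> F) : prime p -> (forall k, 0 <= f k) ->
  \sum_(c : 'F_p) f `|centered_lift c|%N <= 2 * \sum_(k < p.+1) f k.
Proof.
move=> pp f0.
have -> : \sum_(c : 'F_p) f `|centered_lift c|%N = \sum_(0 <= k < p)
    f (if (2 * k <= p)%N then k else p - k)%N.
  have sumE (g : nat -> F) : \sum_(c : 'F_p) g c = \sum_(0 <= k < p) g k.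
    by rewrite -[X in \sum_(0 <= _ < X) _](Fp_cast pp) big_mkord.
  rewrite -sumE; apply: eq_bigr => c _; congr f.
  by have := Fp_ltn c pp; rewrite /centered_lift; case: ifP; lia.
apply: (@le_trans _ _ (\sum_(0 <= k < p) (f k + f (p - k)%N))).
  by apply: ler_sum => k _; case: ifP => _; rewrite ?lerDl ?lerDr.
rewrite big_split /= mulr_natl mulr2n lerD//.
  by rewrite -(big_mkord xpredT f) big_nat_recr //= lerDl.
rewrite big_nat_rev /= add0n -(big_mkord xpredT f) big_nat_recl //=.
rewrite (_ : \sum_(0 <= i < p) _ = \sum_(0 <= i < p) f i.+1) ?lerDr//.
by rewrite big_nat [RHS]big_nat; apply: eq_bigr => k /andP[_ kp]; congr f; lia.
Qed.

Lemma sum_geo_le (F : realType) (x : F) N : 0 <= x < 1 ->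
  \sum_(k < N) x ^+ k <= (1 - x)^-1.
Proof.
move=> /andP[x0 x1]; have h : 0 < 1 - x by rewrite subr_gt0.
rewrite -[leRHS]mul1r ler_pdivlMr// mulrC -opprB mulNr -subrX1 opprB.
by rewrite gerBl exprn_ge0.
Qed.

(** By [centered_lift_min], this is the squared length of the shortest integer lift of [c]. *)
Definition lift_sq (F : realType) n p (c : 'I_n -> 'F_p) : F :=
  \sum_i (centered_lift (c i))%:~R ^+ 2.

Definition short_in (F : realType) n p (W : {set 'I_n}) (r : F) : {set {ffun 'I_n -> 'F_p}} :=
  [set c : {ffun 'I_n -> 'F_p} |
    [forall i, (i \notin W) ==> (c i == 0)] && (lift_sq F c < r ^+ 2)].

(* Chernoff's method: a short vector has weight at least 1 in the sum of the
   exponentials, which factors over the coordinates; the squares are linearised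
   by [2 a <= a^2 + 1] so that each factor is a geometric series. *)
Lemma card_short_in_le (F : realType) n p (W : {set 'I_n}) (r : F) : prime p -> 0 < r ->
  (#|short_in p W r|%:R <= (2 * expR 2 * (1 + r / Num.sqrt #|W|%:R)) ^+ #|W| :> F).
Proof.
move=> pp r0; have [W0|W0] := posnP #|W|.
  rewrite W0 expr0 (_ : 1 = 1%:R :> F)// ler_nat.
  apply: (@leq_trans #|[set [ffun i : 'I_n => 0 : 'F_p]]%SET|); last by rewrite cards1.
  apply/subset_leq_card/fintype.subsetP => c; rewrite !inE => /andP[/forallP h _].
  apply/eqP/ffunP => i; rewrite ffunE; apply/eqP/(implyP (h i)).
  by rewrite (cards0_eq W0) inE.
pose s : F := Num.sqrt #|W|%:R; have s0 : 0 < s by rewrite sqrtr_gt0 ltr0n.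
have s2 : s ^+ 2 = #|W|%:R by rewrite sqr_sqrtr ?ler0n.
(* [q] is the root mean square coordinate of a vector of length [r] supported on [W]. The weight
   [exp (2 - 2 |a| / q)] is at least [exp (1 - a^2 / q^2)], and the exponents [1 - a^2 / q^2] of a
   short vector have a nonnegative sum. *)
pose q := r / s; have q0 : 0 < q by rewrite divr_gt0.
pose x : F := expR (- (2 / q)).
pose g (i : 'I_n) (c : 'F_p) : F :=
  if i \in W then expR 2 * x ^+ `|centered_lift c| else (c == 0)%:R.
have g0 i c : 0 <= g i c by rewrite /g; case: ifP; rewrite ?mulr_ge0 ?exprn_ge0 ?expR_ge0.
have x01 : 0 <= x < 1 by rewrite expR_ge0 /= expR_lt1 oppr_lt0 divr_gt0.
(* This comes from [1 + t <= exp t] at [t = 2 / q]. *)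
have xq : (1 - x)^-1 <= 1 + q.
  have xq : x * (q + 2) <= q.
    have h : x * (1 + 2 / q) <= 1.
      by rewrite /x expRN ler_pdivrMl ?expR_gt0// mulr1 expR_ge1Dx.
    have -> : x * (q + 2) = x * (1 + 2 / q) * q by field; rewrite gt_eqF.
    by rewrite ler_piMl// ltW.
  case/andP: x01 => x0 x1; rewrite -[leLHS]mul1r ler_pdivrMr ?subr_gt0//; nra.
apply: (@le_trans _ _ (\sum_(c : {ffun 'I_n -> 'F_p}) \prod_i g i (c i))).
  rewrite -sum1_card natr_sum big_mkcond /=; apply: ler_sum => c _.
  case: ifPn => [|_]; last by rewrite prodr_ge0.
  rewrite inE => /andP[/forallP cW cr].
  rewrite (bigID (mem W)) /= [X in _ * X]big1 ?mulr1; last first.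
    by move=> i iW; rewrite /g (negbTE iW) (implyP (cW i)).
  rewrite (eq_bigr (fun i => expR (2 - 2 / q * `|centered_lift (c i)|%:R))); last first.
    by move=> i iW; rewrite /g iW [in RHS]expRD -mulNr expRM_natr.
  rewrite -expR_sum -[leLHS]expR0 ler_expR.
  have : lift_sq F c / q ^+ 2 < #|W|%:R.
    rewrite ltr_pdivrMr ?exprn_gt0// /q -s2 expr_div_n mulrC divfK//.
    by rewrite gt_eqF ?exprn_gt0.
  move=> /ltW; rewrite -subr_ge0 => /le_trans; apply.
  rewrite /lift_sq (bigID (mem W)) /= [X in (_ + X) / _]big1 ?addr0; last first.
    by move=> i iW; rewrite (eqP (implyP (cW i) iW)) centered_lift0 expr0n.
  rewrite -sum1_card natr_sum mulr_suml -sumrB; apply: ler_sum => i _; rewrite ?mul1r.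
  have -> : (centered_lift (c i))%:~R ^+ 2 = `|centered_lift (c i)|%:R ^+ 2 :> F.
    by rewrite natr_absz intr_norm real_normK// num_real.
  move: (`|centered_lift (c i)|%:R : F) => a.
  have := sqr_ge0 (a / q - 1); rewrite sqrrB1 expr_div_n -mulr_natl.
  rewrite (_ : 2 / q * a = 2 * (a / q)); last by rewrite mulrAC mulrA.
  lra.
rewrite -bigA_distr_bigA (bigID (mem W)) /= [X in _ * X]big1 ?mulr1; last first.
  move=> i iW; rewrite (bigD1 0)//= big1 ?addr0.
    by rewrite /g (negbTE iW) eqxx.
  by move=> c c0; rewrite /g (negbTE iW) (negbTE c0).
rewrite -prodr_const; apply: ler_prod => i iW; rewrite sumr_ge0//=.
rewrite /g iW -mulr_sumr [2 * _]mulrC -mulrA ler_pM2l ?expR_gt0//.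
apply: le_trans (sum_centered_lift_le pp _) _; first by move=> k; rewrite exprn_ge0 ?expR_ge0.
by rewrite ler_pM2l// (le_trans (sum_geo_le _ x01)).
Qed.

(** Each short vector gets a box with unit sides at its lift on [W] and sides [eta r / sqrt n]
    elsewhere. The boxes are disjoint. The unit sides lengthen a vector by at most
    [sqrt n <= eta r], the others by at most [eta r], hence the radius [r (1 + 2 eta)]. *)
Lemma short_in_box_volume (F : realType) n p (W : {set 'I_n}) (r eta : F) : prime p ->
  (0 < n)%N -> 0 < r -> 0 < eta -> n%:R <= eta ^+ 2 * r ^+ 2 ->
  ((#|short_in p W r|%:R * (eta * r / Num.sqrt n%:R) ^+ (n - #|W|))%:E <=
   leb_vol (@open_ball0 F n (r * (1 + 2 * eta))))%E.
Proof.
move=> pp n0 r0 e0 nr.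
set K := eta * r / _.
have sn0 : 0 < Num.sqrt n%:R :> F by rewrite sqrtr_gt0 ltr0n.
have sn2 : Num.sqrt n%:R ^+ 2 = n%:R :> F by rewrite sqr_sqrtr.
have K0 : 0 < K by rewrite divr_gt0 ?mulr_gt0.
have K2 : K ^+ 2 = eta ^+ 2 * r ^+ 2 / n%:R by rewrite /K expr_div_n exprMn sn2.
pose a (c : {ffun 'I_n -> 'F_p}) i : F := if i \in W then (centered_lift (c i))%:~R else 0.
pose b (c : {ffun 'I_n -> 'F_p}) i : F := if i \in W then (centered_lift (c i))%:~R + 1 else K.
have vol c : \prod_i (b c i - a c i) = K ^+ (n - #|W|).
  rewrite (bigID (mem W)) /= big1 ?mul1r; last first.
    by move=> i iW; rewrite /a /b iW addrAC subrr add0r.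
  rewrite (eq_bigr (fun=> K)); last by move=> i /negbTE iW; rewrite /a /b iW subr0.
  rewrite prodr_const; congr (_ ^+ _).
  by have := cardC (mem W); rewrite card_ord => /esym nE; rewrite [X in (X - _)%N]nE addKn.
have -> : #|short_in p W r|%:R * K ^+ (n - #|W|) =
    \sum_(c in short_in p W r) \prod_i (b c i - a c i).
  by under eq_bigr do rewrite vol; rewrite sumr_const mulr_natl.
apply: leb_vol_ge_packing.
- by move=> c i; rewrite /a /b; case: ifP => _; rewrite ?lerDl ?ltW.
- move=> c; rewrite inE => /andP[/forallP cW cr] y yc.
  rewrite open_ball0E /=; last by rewrite mulr_ge0 ?addr_ge0 ?mulr_ge0 ?ltW.
  (* Young's inequality with weight [eta] removes the cross term of [(k + x)^2]. The sum over [i] is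
     then below [r^2 (1 + 2 eta + 2 eta^2)], which is less than the squared radius. *)
  have yi i : y i ^+ 2 <= (1 + eta) * (centered_lift (c i))%:~R ^+ 2 + (1 + eta^-1 + K ^+ 2).
    have e1 : 0 <= eta^-1 by rewrite invr_ge0 ltW.
    have := yc i; rewrite /a /b; case: ifPn => iW /andP[y1 y2].
      have ee : eta * eta^-1 = 1 by rewrite mulfV// gt_eqF.
      have K20 : 0 <= K ^+ 2 by rewrite sqr_ge0.
      move: y1 y2 ee e1 K20; set k := (centered_lift _)%:~R; set t := eta^-1; move: (K ^+ 2) => K' y1 y2 ee e1 K20.
      have [x yx] : exists x, y i = k + x by exists (y i - k); rewrite addrC subrK.
      rewrite yx; rewrite yx lerDl in y1; rewrite yx ltrD2l in y2.
      have x2 : x ^+ 2 <= 1 by rewrite -[leRHS](expr1n _ 2) ler_sqr ?nnegrE ?ler01// ltW.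
      have x2t : x ^+ 2 * t <= t by rewrite ler_piMl.
      have : 0 <= eta * (k - x * t) ^+ 2 by rewrite mulr_ge0 ?sqr_ge0 ?ltW.
      have -> : eta * (k - x * t) ^+ 2 =
        eta * k ^+ 2 - 2 * k * x * (eta * t) + x ^+ 2 * t * (eta * t) by ring.
      rewrite ee; lra.
    apply: (@le_trans _ _ (K ^+ 2)); first by rewrite ler_sqr ?nnegrE ?(ltW K0) ?(ltW y2).
    have : 0 <= (1 + eta) * (centered_lift (c i))%:~R ^+ 2 by rewrite mulr_ge0 ?sqr_ge0 ?addr_ge0 ?(ltW e0).
    lra.
  apply: (@le_lt_trans _ _ ((1 + eta) * lift_sq F c + n%:R * (1 + eta^-1 + K ^+ 2))).
    rewrite /lift_sq mulr_sumr -[n in n%:R]card_ord -sum1_card natr_sum mulr_suml.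
    by rewrite -big_split /=; apply: ler_sum => i _; rewrite mul1r.
  have -> : n%:R * (1 + eta^-1 + K ^+ 2) = n%:R + n%:R / eta + eta ^+ 2 * r ^+ 2.
    by rewrite !mulrDr mulr1 K2 [n%:R * (_ / _)]mulrC divfK ?gt_eqF ?ltr0n.
  have n1 : n%:R / eta <= eta * r ^+ 2.
    by rewrite ler_pdivrMr// mulrAC -expr2.
  have lr : (1 + eta) * lift_sq F c < (1 + eta) * r ^+ 2 by rewrite ltr_pM2l ?addr_gt0.
  have er : 0 <= eta * r ^+ 2 by rewrite mulr_ge0 ?sqr_ge0 ?ltW.
  have eer : 0 <= eta ^+ 2 * r ^+ 2 by rewrite mulr_ge0 ?sqr_ge0.
  rewrite exprMn; lra.
- move=> c c' y; rewrite !inE => /andP[/forallP cW _] /andP[/forallP cW' _] yc yc'.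
  apply/ffunP => i; have := yc i; have := yc' i; rewrite /a /b.
  case: ifPn => iW; last by rewrite (eqP (implyP (cW i) iW)) (eqP (implyP (cW' i) iW)).
  move=> h1 h2; rewrite -(intr_centered_lift (c i) pp) -(intr_centered_lift (c' i) pp); congr (_%:~R).
  (* On [W] the lift is the floor of any point of the box; off [W] both vectors vanish. *)
  have E (z : int) : (z%:~R <= y i < z%:~R + 1) -> z = Num.floor (y i).
    by move=> h; apply/esym/floor_def; rewrite rmorphD.
  by rewrite (E _ h1) (E _ h2).
Qed.

(** From below, a cube of side [1 / (2 sqrt n)] fits in the ball. From above, the ball of radius
    [sqrt n] is covered by unit cubes at integer points, which the Chernoff bound counts. Only the
    order [n^(-1/2)] of the [n]-th root of the volume will matter. *)
Lemma leb_vol_ball1 (F : realType) n : (0 < n)%N -> exists2 v : F,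
  leb_vol (@open_ball0 F n 1) = v%:E &
  ((2 * Num.sqrt n%:R)^-1) ^+ n <= v <= (8 * expR 2 / Num.sqrt n%:R) ^+ n.
Proof.
move=> n0; set s := Num.sqrt n%:R.
have s0 : 0 < s by rewrite sqrtr_gt0 ltr0n.
have s2 : s ^+ 2 = n%:R by rewrite sqr_sqrtr.
suff /andP[lo hi] : ((((2 * s)^-1) ^+ n)%:E <= leb_vol (@open_ball0 F n 1)
    <= ((8 * expR 2 / s) ^+ n)%:E)%E.
  have vf : leb_vol (@open_ball0 F n 1) \is a fin_num.
    by rewrite ge0_fin_numE ?leb_vol_ge0// (le_lt_trans hi)// ltry.
  exists (fine (leb_vol (@open_ball0 F n 1))); first by rewrite fineK.
  by rewrite -!lee_fin fineK// lo hi.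
have i0 : 0 < (2 * s)^-1 by rewrite invr_gt0 mulr_gt0.
apply/andP; split.
  have := @leb_vol_ge_packing F n unit [set tt]%SET (fun _ _ => 0) (fun _ _ => (2 * s)^-1)
    (@open_ball0 F n 1).
  rewrite big_set1 prodr_const subr0 card_ord; apply.
  - by move=> _ _; exact: ltW.
  - move=> _ _ y yb; rewrite open_ball0E ?ler01//= expr1n.
    apply: (@le_lt_trans _ _ (\sum_(i < n) ((2 * s)^-1) ^+ 2)).
      apply: ler_sum => i _; have /andP[h1 h2] := yb i.
      by rewrite ler_sqr ?nnegrE// ltW.
    rewrite sumr_const card_ord exprVn exprMn s2 -[_ *+ n]mulr_natl.
    rewrite ltr_pdivrMr ?mulr_gt0 ?ltr0n// mul1r ltr_pMl ?ltr0n//.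
    by rewrite -natrX ltr1n.
  - by move=> [] [].
rewrite expr_div_n mulrC EFinM lee_pdivlMl ?exprn_gt0// -leb_vol_ball//.
(* With so large a modulus every floor is its own centered lift. *)
have [q qn pq] := prime_above (2 * n + 4).
(* The floors have squared length below [2 n + 2 n], so radius [3 sqrt n] is enough; it makes the
   Chernoff base [2 e^2 (1 + 3)]. *)
pose D := @short_in F n q [set: 'I_n]%SET (3 * s).
have cD : (#|D|%:R <= (8 * expR 2) ^+ n :> F).
  have := @card_short_in_le F n q [set: 'I_n]%SET (3 * s) pq.
  rewrite mulr_gt0// cardsT card_ord => /(_ isT) /le_trans; apply.
  rewrite -/s mulfK ?gt_eqF//.
  by have -> : 2 * expR 2 * (1 + 3) = 8 * expR 2 :> F by ring.
apply: (@le_trans _ _ (\sum_(c in D) \prod_(i < n)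
    ((centered_lift (c i))%:~R + 1 - (centered_lift (c i))%:~R))%:E); last first.
  rewrite lee_fin; apply: le_trans cD; rewrite -sum1_card natr_sum; apply: ler_sum => c _.
  by rewrite big1// => i _; rewrite addrAC subrr add0r.
apply: leb_vol_le_cover => //; first by move=> c i; rewrite lerDl.
move=> y; rewrite open_ball0E ?ltW//= s2 => ys.
pose c : {ffun 'I_n -> 'F_q} := [ffun i => (Num.floor (y i))%:~R].
have yn i : y i ^+ 2 < n%:R ^+ 2.
  apply: le_lt_trans (lt_le_trans ys _); last by rewrite -natrX ler_nat -{1}[n]expn1 leq_pexp2l.
  by rewrite (bigD1 i)//= lerDl sumr_ge0// => j _; rewrite sqr_ge0.
have cE i : centered_lift (c i) = Num.floor (y i).
  rewrite ffunE centered_lift_small//.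
  have : `|y i| < n%:R by rewrite -ltr_sqr ?nnegrE// real_normK ?num_real.
  rewrite ltr_norml => /andP[y1 y2].
  have f1 : (Num.floor (y i) < n%:Z)%R by rewrite real_floor_lt_int ?num_real.
  have f2 : (- n%:Z <= Num.floor (y i))%R.
    by rewrite real_floor_ge_int ?num_real// mulrNz ltW.
  lia.
exists c; last by move=> i; rewrite cE -[X in _ < _ + X]/(1%:~R) -rmorphD; apply: real_floor_itv; rewrite num_real.
rewrite inE; apply/andP; split; first by apply/forallP => i; rewrite inE.
rewrite exprMn s2 /lift_sq.
apply: (@le_lt_trans _ _ (\sum_(i < n) (2 * y i ^+ 2 + 2))).
  apply: ler_sum => i _; rewrite cE.
  have := real_floor_itv (num_real (y i)); rewrite rmorphD /= => /andP[].
  set z := (Num.floor _)%:~R => z1 z2.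
  have [x yx] : exists x, y i = z + x by exists (y i - z); rewrite addrC subrK.
  rewrite yx; rewrite yx lerDl in z1; rewrite yx ltrD2l in z2.
  have x2 : x ^+ 2 <= 1 by rewrite -[leRHS](expr1n _ 2) ler_sqr ?nnegrE ?ler01// ltW.
  have := sqr_ge0 (z + 2 * x); lra.
rewrite big_split /= -mulr_sumr sumr_const card_ord -[_ *+ n]mulr_natl; nra.
Qed.

(** * The dual lattice *)

Definition codeword m n p (G : 'I_m -> 'I_n -> bool) (h : {ffun 'I_m * 'I_n -> 'F_p})
    (u : {ffun 'I_m -> 'F_p}) : {ffun 'I_n -> 'F_p} :=
  [ffun j => \sum_i u i * ((G i j)%:R * h (i, j))].

Lemma codewordB m n p (G : 'I_m -> 'I_n -> bool) (h : {ffun 'I_m * 'I_n -> 'F_p}) u u' j :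
  codeword G h (u - u') j = codeword G h u j - codeword G h u' j.
Proof. by rewrite !ffunE -sumrB; apply: eq_bigr => i _; rewrite !ffunE mulrBl. Qed.

(** Modulo [p], the inner product of [x] and [z] is [u H x], and [H x = 0]. *)
Lemma dual_lattice_codeword (F : realType) m n p (G : 'I_m -> 'I_n -> bool)
    (h : {ffun 'I_m * 'I_n -> 'F_p}) (u : {ffun 'I_m -> 'F_p}) (z : 'I_n -> int) :
  prime p -> (forall j, (z j)%:~R = codeword G h u j) ->
  dual_lattice (LDA_lattice G h) (fun j => (z j)%:~R / p%:R : F).
Proof.
move=> pp zu x Lx.
have : ((\sum_j x j * z j)%:~R == 0 :> 'F_p).
  rewrite rmorph_sum /=; apply/eqP.
  under eq_bigr => j _ do rewrite rmorphM /= zu ffunE mulr_sumr.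
  rewrite exchange_big big1 //= => i _.
  rewrite (eq_bigr (fun j => u i * ((G i j)%:R * h (i, j) * (x j)%:~R))); last first.
    by move=> j _; ring.
  by rewrite -mulr_sumr Lx mulr0.
have p0 : p%:R != 0 :> F by rewrite pnatr_eq0 -lt0n prime_gt0.
rewrite intr_Fp_eq0// => /(@dvdzP p%:Z)[t xz]; exists t.
rewrite -[RHS](mulfK p0) pmulrn -rmorphM -xz rmorph_sum mulr_suml.
by apply: eq_bigr => j _; rewrite rmorphM mulrA.
Qed.

(** Pairing with [p e_j], which lies in the lattice, shows that [p l] is integral. Pairing with
    lifts of the columns of [cokermx H], which are killed by [H], shows that its residue lies in the
    row space. *)
Lemma codeword_dual_lattice (F : realType) m n p (G : 'I_m -> 'I_n -> bool)
    (h : {ffun 'I_m * 'I_n -> 'F_p}) (l : 'I_n -> F) :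
  prime p -> dual_lattice (LDA_lattice G h) l ->
  exists (z : 'I_n -> int) (u : {ffun 'I_m -> 'F_p}),
    (forall j, l j = (z j)%:~R / p%:R) /\ (forall j, (z j)%:~R = codeword G h u j).
Proof.
move=> pp Ll.
have p0 : p%:R != 0 :> F by rewrite pnatr_eq0 -lt0n prime_gt0.
have : forall j, exists z : int, l j = z%:~R / p%:R.
  move=> j; have [|z lz] := Ll (fun k => if k == j then p%:Z else 0).
    move=> i; rewrite (bigD1 j)//= eqxx -pmulrn pchar_Fp_0// mulr0 add0r big1// => k /negbTE->.
    by rewrite mulr0.
  exists z; rewrite -lz /dotp (bigD1 j)//= eqxx big1 ?addr0.
    by rewrite mulrAC -pmulrn mulfV// mul1r.
  by move=> k /negbTE->; rewrite mul0r.
move=> /choice[z lz]; exists z.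
pose H := (\matrix_(i < m, j < n) ((G i j)%:R * h (i, j)))%R.
pose Z := (\row_(j < n) ((z j)%:~R : 'F_p))%R.
have : (Z <= H)%MS.
  rewrite submxE; apply/eqP/matrixP => a k; rewrite !mxE.
  have Lx : LDA_lattice G h (fun j => (cokermx H j k : nat)%:Z).
    move=> i; have := mulmx_coker H => /matrixP/(_ i k); rewrite !mxE => e.
    rewrite -[RHS]e; apply: eq_bigr => j _; rewrite !mxE.
    by congr (_ * _); rewrite -pmulrn natr_Zp.
  have [t] := Ll _ Lx; rewrite /dotp => /esym et.
  have : (\sum_j (cokermx H j k : nat)%:Z * z j) = t * p%:Z.
    apply: (@intr_inj F); rewrite rmorphM /= et mulr_suml [LHS]rmorph_sum.
    by apply: eq_bigr => j _; rewrite rmorphM /= lz -mulrA -!pmulrn divfK.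
  move/(congr1 (fun x : int => x%:~R : 'F_p)).
  rewrite rmorphM /= -!pmulrn pchar_Fp_0// mulr0 rmorph_sum /= => e; rewrite -[RHS]e.
  by apply: eq_bigr => j _; rewrite !mxE rmorphM /= mulrC -pmulrn natr_Zp.
move=> /submxP[D ZD]; exists [ffun i => D 0 i]; split => // j.
move/matrixP: ZD => /(_ 0 j); rewrite !mxE => ->.
by rewrite ffunE; apply: eq_bigr => i _; rewrite !mxE ffunE.
Qed.

Lemma dual_lattice_int (F : realType) n (L : set ('I_n -> int)) (z : 'I_n -> int) :
  dual_lattice L (fun j => (z j)%:~R : F).
Proof.
move=> x _; exists (\sum_j x j * z j); rewrite rmorph_sum /=.
by apply: eq_bigr => j _; rewrite rmorphM.
Qed.

Lemma dual_latticeN (F : realType) n (L : set ('I_n -> int)) (l : 'I_n -> F) :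
  dual_lattice L l -> dual_lattice L (fun j => - l j).
Proof.
move=> Ll x /Ll[z xz]; exists (- z); rewrite rmorphN /= -xz /dotp -sumrN.
by apply: eq_bigr => j _; rewrite mulrN.
Qed.

(** * The Voronoi cell of the dual lattice *)

Lemma sum_sqrB (F : realType) n (y l : 'I_n -> F) :
  \sum_i (y i - l i) ^+ 2 =
  \sum_i y i ^+ 2 - 2 * (\sum_i y i * l i) + \sum_i l i ^+ 2.
Proof.
rewrite mulr_sumr -sumrB -big_split /=; apply: eq_bigr => i _; ring.
Qed.

(** Expanding [|y - l|^2] presents the cell as an intersection of half-spaces, a form linear in [y]
    that suits scaling and rounding. *)
Lemma voronoiE (F : realType) n (L : set ('I_n -> F)) y :
  voronoi L y <-> forall l, L l -> 2 * (\sum_i y i * l i) <= \sum_i l i ^+ 2.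
Proof.
have E l : (enorm y <= enorm (fun i => y i - l i)) =
    (2 * (\sum_i y i * l i) <= \sum_i l i ^+ 2).
  rewrite -ler_sqr ?nnegrE ?enorm_ge0// !sqr_enorm sum_sqrB.
  by rewrite -subr_ge0 -[RHS]subr_ge0; congr (0 <= _); ring.
by split => h l /h; rewrite E.
Qed.

(* Counting grid cubes bounds the volume of anything well inside the open cell,
   hence the shrinking by [1 - eta]. *)
Lemma leb_vol_voronoi (F : realType) m n p (G : 'I_m -> 'I_n -> bool)
    (h : {ffun 'I_m * 'I_n -> 'F_p}) (eta : F) : prime p -> (0 < n)%N -> 0 < eta < 1 ->
  (forall u, codeword G h u = 0 -> u = 0) ->
  (((1 - eta) ^+ n)%:E * leb_vol (voronoi (@dual_lattice F _ (LDA_lattice G h))) <=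
   (p%:R ^- m)%:E)%E.
Proof.
move=> pp n0 /andP[e0 e1] inj; set L := dual_lattice _; set V := voronoi L.
have pR0 : 0 < p%:R :> F by rewrite ltr0n prime_gt0.
have e1' : 0 < 1 - eta by rewrite subr_gt0.
(* The grid [1 / (p M)] must be fine enough for the rounding error to fit in the margin [eta]; see
   [h3]. *)
pose M := (Num.truncn (4 * n%:R / eta ^+ 2)).+1.
have M0 : 0 < M%:R :> F by rewrite ltr0n.
have Mbig : 4 * n%:R / eta ^+ 2 < M%:R.
  by apply: truncnS_gt.
pose N := (p * M)%N.
have N1 : (1 < N)%N by rewrite /N (leq_trans (prime_gt1 pp))// leq_pmulr.
have NR0 : 0 < N%:R :> F by rewrite ltr0n ltnW.
have NE : N%:R = p%:R * M%:R :> F by rewrite natrM.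
have ZN_eq0 (z : int) : (z%:~R == 0 :> 'Z_N) -> (N%:Z %| z)%Z.
  have ZN_nat k : (k%:R == 0 :> 'Z_N) -> (N %| k)%N.
    by move=> /eqP/(congr1 val); rewrite /= val_Zp_nat// => /eqP.
  rewrite dvdzE absz_nat; case: (intP z) => [|k|k]; rewrite ?absz0 ?dvdn0//.
    by rewrite -pmulrn; exact: ZN_nat.
  by rewrite mulrNz oppr_eq0 -pmulrn abszN; exact: ZN_nat.
(* The open cell. If [l = y - y'] is a nonzero lattice vector, the strict inequalities for [y, l]
   and [y', -l] add up to [2 |l|^2 < 2 |l|^2], so inner points are distinct modulo [L]. *)
pose inner (y : 'I_n -> F) :=
  forall l, L l -> (exists i, l i != 0) -> 2 * (\sum_i y i * l i) < \sum_i l i ^+ 2.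
have inner_inj y y' : inner y -> inner y' -> L (fun i => y i - y' i) -> y = y'.
  move=> iy iy' Lyy'; apply/funext => i; apply/eqP; rewrite -subr_eq0.
  apply/negP => /negP ne.
  have h1 := iy _ Lyy' (ex_intro _ i ne).
  have := iy' _ (dual_latticeN Lyy'); have ne' : - (y i - y' i) != 0 by rewrite oppr_eq0.
  move=> /(_ (ex_intro _ i ne')) h2.
  have := sum_sqrB y y'.
  have E : \sum_i (- (y i - y' i)) ^+ 2 = \sum_i (y i - y' i) ^+ 2.
    by apply: eq_bigr => j _; rewrite sqrrN.
  have E2 : \sum_i y' i * - (y i - y' i) = \sum_i y' i ^+ 2 - \sum_i y i * y' i.
    by rewrite -sumrB; apply: eq_bigr => j _; ring.
  have E1 : \sum_i y i * (y i - y' i) = \sum_i y i ^+ 2 - \sum_i y i * y' i.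
    by rewrite -sumrB; apply: eq_bigr => j _; ring.
  move: h1 h2; rewrite E E1 E2; lra.
pose grid (g : 'I_n -> int) i : F := (g i)%:~R / N%:R.
(* Classes modulo [N] stand for grid points modulo integer vectors, which makes the set finite; [g]
   picks an inner representative of each class. *)
pose D := [set c : {ffun 'I_n -> 'Z_N} |
  `[< exists g : 'I_n -> int, (forall i, (g i)%:~R = c i) /\ inner (grid g) >] ]%SET.
have [g gP] : exists g : {ffun 'I_n -> 'Z_N} -> 'I_n -> int,
    forall c, c \in D -> (forall i, (g c i)%:~R = c i) /\ inner (grid (g c)).
  have /choice[g gP] : forall c : {ffun 'I_n -> 'Z_N}, exists g : 'I_n -> int,
      c \in D -> (forall i, (g i)%:~R = c i) /\ inner (grid g).
    move=> c; have [|cD] := boolP (c \in D); last by exists (fun=> 0).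
    by rewrite inE => /asboolP[g gP]; exists g.
  by exists g.
(* The translates of the grid points of the open cell by the [p ^ m] classes of
   [L] modulo integer vectors are distinct modulo [N]. *)
have card_D : (#|D| * p ^ m <= N ^ n)%N.
  pose phi (cu : {ffun 'I_n -> 'Z_N} * {ffun 'I_m -> 'F_p}) : {ffun 'I_n -> 'Z_N} :=
    [ffun i => (g cu.1 i + M%:Z * (codeword G h cu.2 i : nat)%:Z)%:~R].
  have phi_inj : {in finset.setX D [set: {ffun 'I_m -> 'F_p}]%SET &, injective phi}.
    move=> [c u] [c' u']; rewrite !finset.in_setX /= => /andP[cD _] /andP[c'D _] /ffunP e.
    have /choice[k kP] : forall i, exists k : int,
        (g c i - g c' i = M%:Z * ((codeword G h u' i : nat)%:Z - (codeword G h u i : nat)%:Z + p%:Z * k)).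
      move=> i; have := e i; rewrite !ffunE /= => /eqP; rewrite -subr_eq0 -rmorphB.
      move=> /ZN_eq0 /dvdzP[k ek]; exists k; move: ek; rewrite /N; lia.
    have eg : grid (g c) = grid (g c').
      apply: inner_inj; [exact: (gP _ cD).2|exact: (gP _ c'D).2|].
      pose z i : int := (codeword G h u' i : nat)%:Z - (codeword G h u i : nat)%:Z + p%:Z * k i.
      have -> : (fun i => grid (g c) i - grid (g c') i) = (fun i => (z i)%:~R / p%:R).
        apply/funext => i; rewrite /grid -mulrBl -rmorphB kP rmorphM /= NE -pmulrn -/(z i).
        by field; rewrite !gt_eqF.
      apply: (@dual_lattice_codeword F m n p G h (u' - u)) => // i.
      rewrite codewordB !(rmorphD, rmorphM, rmorphN) /= -!pmulrn !natr_Zp.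
      by rewrite pchar_Fp_0// mul0r addr0.
    have egc i : g c i = g c' i.
      have := congr1 (fun f => f i * N%:R) eg; rewrite /grid !divfK ?gt_eqF//; exact: intr_inj.
    have -> : c = c' by apply/ffunP => i; rewrite -(gP _ cD).1 -(gP _ c'D).1 egc.
    congr pair; apply/esym/eqP; rewrite -subr_eq0; apply/eqP/inj/ffunP => i.
    rewrite codewordB [RHS]ffunE; apply/eqP; rewrite subr_eq0; apply/eqP.
    have := kP i; rewrite egc subrr => /esym/eqP; rewrite mulf_eq0 => /orP[//|/eqP].
    move/(congr1 (fun x : int => x%:~R : 'F_p)).
    rewrite !(rmorphD, rmorphM, rmorphN) /= -!pmulrn !natr_Zp pchar_Fp_0// mul0r addr0.
    by move/eqP; rewrite subr_eq0 => /eqP.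
  have := card_in_imset phi_inj; rewrite cardsX cardsT card_ffun card_Fp// card_ord => <-.
  rewrite -[X in (_ <= X ^ _)%N](Zp_cast N1) -[X in (_ <= _ ^ X)%N]card_ord -[X in (_ <= X ^ _)%N]card_ord.
  by rewrite -card_ffun max_card.
rewrite -leb_vol_scale//.
(* Rounding a point of the shrunken cell down to the grid gives an inner point, so the cubes of side
   [1 / N] at the points of [D] cover it. *)
apply: (@le_trans _ _ (\sum_(c in D) \prod_(i < n) (grid (g c) i + N%:R^-1 - grid (g c) i))%:E).
  apply: leb_vol_le_cover => //.
    by move=> c i; rewrite lerDl invr_ge0 ltW.
  move=> y /= Vy.
  pose f i := Num.floor (N%:R * y i).
  have fy : box (grid f) (fun i => grid f i + N%:R^-1) y.
    move=> i; have -> : grid f i + N%:R^-1 = (f i + 1)%:~R / N%:R.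
      by rewrite rmorphD /= mulrDl mul1r.
    by rewrite /grid ler_pdivrMr// ltr_pdivlMr// mulrC; apply: real_floor_itv; rewrite num_real.
  have fi : inner (grid f).
    move=> l Ll [i0 li0].
    (* A nonzero dual vector is [1 / p] times a nonzero integer vector. *)
    have ll : p%:R ^- 2 <= \sum_i l i ^+ 2.
      have [z [u [lz _]]] := codeword_dual_lattice pp Ll.
      rewrite (bigD1 i0)//= ler_wpDr ?sumr_ge0//; first by move=> j _; rewrite sqr_ge0.
      rewrite lz expr_div_n -[leLHS]mul1r ler_pM2r ?invr_gt0 ?exprn_gt0//.
      rewrite -rmorphXn /= (_ : 1 = 1%:~R)// ler_int.
      have : z i0 != 0 by apply: contraNneq li0 => z0; rewrite lz z0 mul0r.
      by move: (z i0) => t t0; rewrite -[1]/(1%:Z); nia.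
    set Q := \sum_i l i ^+ 2 in ll *.
    have Q0 : 0 < Q by apply: lt_le_trans ll; rewrite invr_gt0 exprn_gt0.
    have h1 : 2 * (\sum_i y i * l i) <= (1 - eta) * Q.
      have := (voronoiE _ _).1 Vy _ Ll; rewrite -/Q.
      under eq_bigr do rewrite -mulrA.
      by rewrite -mulr_sumr mulrCA ler_pdivrMl.
    (* The rounding error costs [eta / 2] of [Q] by Young's inequality, and less than another
       [eta / 2] by the choice of [M]; the shrinking left room for exactly [eta]. *)
    have h2 : 2 * (\sum_i (grid f i - y i) * l i) <= 2 / eta * (n%:R / N%:R ^+ 2) + eta / 2 * Q.
      have -> : n%:R / N%:R ^+ 2 = \sum_(i < n) (N%:R ^+ 2)^-1 :> F by rewrite sumr_const card_ord mulr_natl.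
      rewrite /Q !mulr_sumr -big_split /=; apply: ler_sum => i _.
      have /andP[f1 f2] := fy i.
      have [x xE] : exists x, y i = grid f i + x by exists (y i - grid f i); rewrite addrC subrK.
      rewrite xE in f1 f2 *; rewrite lerDl in f1; rewrite ltrD2l in f2.
      have x2 : x ^+ 2 <= (N%:R ^+ 2)^-1 by rewrite -exprVn ler_sqr ?nnegrE ?invr_ge0 ?(ltW NR0) ?(ltW f2).
      apply: (@le_trans _ _ (2 / eta * x ^+ 2 + eta / 2 * l i ^+ 2)); last first.
        by rewrite lerD2r ler_pM2l// divr_gt0.
      rewrite -subr_ge0.
      have -> : 2 / eta * x ^+ 2 + eta / 2 * l i ^+ 2 - 2 * ((grid f i - (grid f i + x)) * l i) =
        2 / eta * (x + eta / 2 * l i) ^+ 2 by field; rewrite gt_eqF.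
      by rewrite mulr_ge0 ?sqr_ge0 ?divr_ge0 ?ltW.
    have -> : \sum_i grid f i * l i = \sum_i y i * l i + \sum_i (grid f i - y i) * l i.
      by rewrite -big_split /=; apply: eq_bigr => i _; ring.
    have h3 : 2 / eta * (n%:R / N%:R ^+ 2) < eta / 2 * Q.
      apply: (@lt_le_trans _ _ (eta / 2 * p%:R ^- 2)); last by rewrite ler_pM2l ?divr_gt0.
      have -> : 2 / eta * (n%:R / N%:R ^+ 2) =
          eta / 2 * p%:R ^- 2 * (4 * n%:R / eta ^+ 2 / M%:R ^+ 2).
        by rewrite NE; field; rewrite !gt_eqF.
      rewrite gtr_pMr ?mulr_gt0 ?invr_gt0 ?exprn_gt0//.
      rewrite ltr_pdivrMr ?exprn_gt0// mul1r (lt_le_trans Mbig)//.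
      by rewrite expr2 ler_pMr// ler1n.
    rewrite mulrDr; lra.
  pose c : {ffun 'I_n -> 'Z_N} := [ffun i => (f i)%:~R].
  have cD : c \in D by rewrite inE; apply/asboolP; exists f; split => // i; rewrite ffunE.
  (* The chosen representative and the rounded point agree modulo [N], so they differ by an integer
     vector, which is in [L]; being inner, they coincide. *)
  exists c => //; suff -> : grid (g c) = grid f by [].
  apply: inner_inj => //; first exact: (gP _ cD).2.
  have /choice[k kP] : forall i, exists k : int, g c i - f i = k * N%:Z.
    move=> i; apply/dvdzP/ZN_eq0; rewrite rmorphB /= (gP _ cD).1 ffunE.
    by rewrite subrr.
  have -> : (fun i => grid (g c) i - grid f i) = (fun i => (k i)%:~R).
    apply/funext => i; rewrite /grid -mulrBl -rmorphB kP rmorphM /=.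
    by rewrite -pmulrn mulfK ?gt_eqF.
  exact: dual_lattice_int.
under eq_bigr do under eq_bigr do rewrite addrAC subrr add0r.
rewrite prodr_const sumr_const card_ord lee_fin -[_ *+ _]mulr_natl exprVn.
rewrite ler_pdivrMr ?exprn_gt0// ler_pdivlMl ?exprn_gt0// mulrC.
by rewrite -!natrX -natrM ler_nat.
Qed.

(** The nonzero dual vectors have norm at least [r / p], so a ball of half that radius lies in the
    cell; [leb_vol_voronoi] with [eta] tending to 0 gives [r_eff <= rho]. *)
Lemma r_pack_r_eff_ge (F : realType) m n p (G : 'I_m -> 'I_n -> bool)
    (h : {ffun 'I_m * 'I_n -> 'F_p}) (r rho v : F) :
  prime p -> (0 < n)%N -> 0 < r <= p%:R -> 0 < rho ->
  leb_vol (@open_ball0 F n 1) = v%:E -> 0 < v -> rho ^+ n * v = p%:R ^- m ->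
  (forall u, u != 0 -> r ^+ 2 <= lift_sq F (codeword G h u)) ->
  r / (2 * p%:R) / rho <= r_pack (@dual_lattice F _ (LDA_lattice G h)) /
     r_eff (@dual_lattice F _ (LDA_lattice G h)).
Proof.
move=> pp n0 /andP[r0 rp] rho0 volB v0 rhoE hu; set L := dual_lattice _.
have pR0 : 0 < p%:R :> F by rewrite ltr0n prime_gt0.
pose t := r / (2 * p%:R); have t0 : 0 < t by rewrite divr_gt0 ?mulr_gt0.
have lift_sq0 : lift_sq F (0 : {ffun 'I_n -> 'F_p}) = 0.
  by rewrite /lift_sq big1// => i _; rewrite ffunE centered_lift0 expr0n.
have inj u : codeword G h u = 0 -> u = 0.
  move=> cu; apply/eqP; apply: contraT => /hu; rewrite cu lift_sq0.
  by rewrite leNgt exprn_gt0.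
have Lmin l : L l -> (exists i, l i != 0) -> 4 * t ^+ 2 <= \sum_i l i ^+ 2.
  move=> Ll [i0 li0]; have [z [u [lz zu]]] := codeword_dual_lattice pp Ll.
  have -> : 4 * t ^+ 2 = r ^+ 2 / p%:R ^+ 2 by rewrite /t; field; rewrite gt_eqF.
  have -> : \sum_i l i ^+ 2 = (\sum_i (z i)%:~R ^+ 2) / p%:R ^+ 2.
    by rewrite mulr_suml; apply: eq_bigr => i _; rewrite lz expr_div_n.
  rewrite ler_pM2r ?invr_gt0 ?exprn_gt0//.
  (* For [u != 0] the lift is at least as long as the centered one. For [u = 0] a nonzero coordinate
     is a multiple of [p], and [r <= p]. *)
  have [u0|u0] := eqVneq u 0; last first.
    apply: le_trans (hu u u0) _; apply: ler_sum => i _; rewrite -zu.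
    rewrite -!rmorphXn /= ler_int.
    have := centered_lift_min (z i) pp; move: (centered_lift _) => a; move: (z i) => b; nia.
  rewrite (bigD1 i0)//= ler_wpDr ?sumr_ge0//; first by move=> j _; rewrite sqr_ge0.
  apply: (@le_trans _ _ (p%:R ^+ 2)); first by rewrite ler_sqr ?nnegrE// ltW.
  have z0 : z i0 != 0 by apply: contraNneq li0 => z0; rewrite lz z0 mul0r.
  have : (p %| `|z i0|)%N.
    by rewrite -intr_Fp_eq0// zu u0 ffunE big1// => i _; rewrite ffunE mul0r.
  move=> /dvdn_leq; rewrite absz_gt0 => /(_ z0) pz.
  rewrite pmulrn -!rmorphXn /= ler_int; move: (z i0) pz => x; nia.
have ballV : @open_ball0 F n t `<=` voronoi L.
  move=> y; rewrite open_ball0E ?ltW//= => yt; apply/voronoiE => l Ll.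
  have [l_neq0|l_eq0] := pselect (exists i, l i != 0); last first.
    have l0 i : l i = 0 by apply/eqP; apply: contra_notT l_eq0 => li; exists i.
    by rewrite !big1 ?mulr0// => i _; rewrite l0 ?expr0n ?mulr0.
  have := Lmin l Ll l_neq0.
  have : 2 * (\sum_i y i * l i) <= 2 * (\sum_i y i ^+ 2) + 2^-1 * (\sum_i l i ^+ 2).
    rewrite !mulr_sumr -big_split /=; apply: ler_sum => i _.
    have := sqr_ge0 (2 * y i - l i); lra.
  lra.
have r_pack_ge : t <= r_pack L.
  apply: ub_le_sup; last by split => //; exact: ltW.
  (* The [sup] needs a bounded set: a ball of radius above 1 contains [3/4] of a unit vector, which
     is closer to that unit vector than to 0. *)
  exists 1 => s [s0 sV]; rewrite leNgt; apply/negP => s1.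
  pose i0 := Ordinal n0; pose y (i : 'I_n) : F := if i == i0 then 3 / 4 else 0.
  have sum1 (f : 'I_n -> F) : (forall i, i != i0 -> f i = 0) -> \sum_i f i = f i0.
    by move=> f0; rewrite (bigD1 i0)//= big1 ?addr0.
  have /sV/voronoiE/(_ _ (@dual_lattice_int F n _ (fun i => (i == i0)%:Z))) : open_ball0 s y.
    rewrite open_ball0E//= sum1; last by move=> i /negbTE ii; rewrite /y ii expr0n.
    rewrite /y eqxx ltr_sqr ?nnegrE ?divr_ge0//; lra.
  rewrite !sum1; last 2 first.
  - by move=> i /negbTE->; rewrite expr0n.
  - by move=> i /negbTE->; rewrite mulr0.
  rewrite /y !eqxx /= mulr1z mulr1 expr1n; lra.
have Vge : ((t ^+ n * v)%:E <= leb_vol (voronoi L))%E.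
  by rewrite EFinM -volB -leb_vol_ball//; exact: le_leb_vol.
have Vle eta : 0 < eta < 1 -> (((1 - eta) ^+ n)%:E * leb_vol (voronoi L) <= (p%:R ^- m)%:E)%E.
  by move=> e; exact: leb_vol_voronoi.
(* The volume of the cell is finite and positive, so some ball has the same volume and [xget] does
   not fall back on its default 0. *)
have [w wE] : exists w, leb_vol (voronoi L) = w%:E.
  have : (0 < 2^-1 :> F) && (2^-1 < 1 :> F) by rewrite invr_gt0 ltr0n invf_lt1 ?ltr1n.
  have h0 : 0 < (1 - 2^-1) ^+ n :> F by rewrite exprn_gt0//; lra.
  move=> /Vle; rewrite -lee_pdivlMl// => h2; exists (fine (leb_vol (voronoi L))); rewrite fineK//.
  by rewrite ge0_fin_numE ?leb_vol_ge0// (le_lt_trans h2)// -EFinM ltry.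
have w0 : 0 < w.
  by move: Vge; rewrite wE lee_fin; apply: lt_le_trans; rewrite mulr_gt0 ?exprn_gt0.
have [s0 sV] : 0 <= r_eff L /\ leb_vol (@open_ball0 F n (r_eff L)) = leb_vol (voronoi L).
  pose S := [set r : F | 0 <= r /\ leb_vol (@open_ball0 F n r) = leb_vol (voronoi L)].
  suff : S (r_eff L) by [].
  apply: (@xgetPex _ 0 S); exists ((w / v) `^ (n%:R^-1)); split.
    exact: powR_ge0.
  rewrite leb_vol_ball; last by rewrite powR_gt0// divr_gt0.
  rewrite -powR_mulrn ?powR_ge0// -powRrM mulVf ?pnatr_eq0 -?lt0n// powRr1 ?divr_ge0 ?ltW//.
  by rewrite volB -EFinM divfK ?gt_eqF.
have s1 : 0 < r_eff L.
  rewrite lt_neqAle s0 andbT; apply/negP => /eqP s00; move: sV; rewrite -s00 => sV.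
  have := @leb_vol_le_cover F n bool finset.set0 (fun _ _ => 0) (fun _ _ => 0)
    (@open_ball0 F n 0) n0.
  rewrite big_set0 sV wE lee_fin [w <= _]leNgt w0 /=; move=> H; suff : false by []; apply: H => //.
  by move=> y; rewrite /open_ball0/= ltNge enorm_ge0.
have seta eta : 0 < eta < 1 -> (1 - eta) * r_eff L <= rho.
  move=> e; have := Vle eta e; rewrite -sV leb_vol_ball// volB -!EFinM lee_fin -rhoE mulrA.
  have e0 : 0 < 1 - eta by case/andP: e; rewrite subr_gt0.
  by rewrite ler_pM2r// -exprMn ler_pXn2r ?nnegrE ?mulr_ge0 ?(ltW e0) ?(ltW rho0).
have s_le : r_eff L <= rho.
  rewrite leNgt; apply/negP => lt.
  (* This [eta] makes [(1 - eta) r_eff] the midpoint of [rho] and [r_eff], which would exceed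
     [rho]. *)
  have := seta ((r_eff L - rho) / (2 * r_eff L)).
  have d0 : 0 < 2 * r_eff L by rewrite mulr_gt0.
  rewrite divr_gt0 ?subr_gt0// ltr_pdivrMr//= => H.
  have {}H : (1 - (r_eff L - rho) / (2 * r_eff L)) * r_eff L <= rho by apply: H; lra.
  move: H; rewrite leNgt => /negP; apply.
  have -> : (1 - (r_eff L - rho) / (2 * r_eff L)) * r_eff L = (r_eff L + rho) / 2.
    by field; rewrite gt_eqF.
  lra.
rewrite -/t; apply: ler_pM; rewrite ?invr_ge0 ?(ltW t0) ?(ltW rho0)//.
by rewrite lef_pV2 ?posrE.
Qed.

(** * The union bound *)

Definition supp m p (u : {ffun 'I_m -> 'F_p}) : {set 'I_m} := [set i | u i != 0].

Lemma codeword_supp m n p (G : 'I_m -> 'I_n -> bool) (h : {ffun 'I_m * 'I_n -> 'F_p}) u j :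
  j \notin nbC G (supp u) -> codeword G h u j = 0.
Proof.
rewrite inE => /existsPn jT; rewrite ffunE big1// => i _.
have := jT i; rewrite inE; case: eqVneq => [->|_ /=]; first by rewrite mul0r.
by move=> /negbTE ->; rewrite mul0r mulr0.
Qed.

(* Shifting, for every [j] in the neighbourhood of the support of [u], the
   multiplier of one edge at [j] shifts the codeword of [u] arbitrarily there. *)
Lemma card_codeword_eq m n p (G : 'I_m -> 'I_n -> bool) (u : {ffun 'I_m -> 'F_p})
    (c : {ffun 'I_n -> 'F_p}) : prime p ->
  (#|[set h | codeword G h u == c]%SET| * p ^ #|nbC G (supp u)| <=
    #|{: {ffun 'I_m * 'I_n -> 'F_p}}|)%N.
Proof.
move=> pp; set W := nbC G (supp u).
pose B := [set d : {ffun 'I_n -> 'F_p} | d \in pffun_on 0 (mem W) predT]%SET.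
have cB : #|B| = (p ^ #|W|)%N by rewrite cardsE card_pffun_on card_Fp.
have BW d j : d \in B -> j \notin W -> d j = 0.
  by rewrite inE => /pffun_onP[/supportP dW _] /dW.
pose pk j := [pick i | (u i != 0) && G i j].
have pkW j : j \in W -> exists2 i, pk j = Some i & (u i != 0) && G i j.
  rewrite inE => /existsP[i]; rewrite inE => iP; rewrite /pk; case: pickP => [i' ?|/(_ i)].
    by exists i'.
  by rewrite iP.
pose e (d : {ffun 'I_n -> 'F_p}) : {ffun 'I_m * 'I_n -> 'F_p} :=
  [ffun ij => if pk ij.2 == Some ij.1 then d ij.2 else 0].
pose phi (hd : {ffun 'I_m * 'I_n -> 'F_p} * {ffun 'I_n -> 'F_p}) := hd.1 + e hd.2.
have codeD h d j i : pk j = Some i -> G i j ->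
    codeword G (h + e d) u j = codeword G h u j + u i * d j.
  move=> ji Gij; rewrite !ffunE.
  have -> : u i * d j = \sum_k u k * ((G k j)%:R * e d (k, j)).
    rewrite (bigD1 i)//= ffunE /= ji eqxx Gij mul1r big1 ?addr0// => k ki.
    by rewrite ffunE /= ji; case: eqP => [[ik]|_]; [rewrite ik eqxx in ki|rewrite !mulr0].
  by rewrite -big_split /=; apply: eq_bigr => k _; rewrite ffunE !mulrDr.
(* The map [phi] is injective on pairs whose [h] has codeword [c]: the codeword of the image reveals
   [d], hence [h]. *)
rewrite -cB -cardsX -(@card_in_imset _ _ phi); first exact: max_card.
move=> [h d] [h' d']; rewrite !finset.in_setX /=.
move=> /andP[]; rewrite inE => /eqP hc dB /andP[]; rewrite inE => /eqP h'c d'B e_eq.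
have dd' : d = d'.
  apply/ffunP => j; have [jW|jW] := boolP (j \in W); last by rewrite !(BW _ j).
  have [i ji /andP[ui Gij]] := pkW j jW.
  have := congr1 (fun g => codeword G g u j) e_eq; rewrite /phi /= !(codeD _ _ _ _ ji Gij).
  by rewrite hc h'c => /addrI/(mulfI ui).
by move: e_eq; rewrite /phi /= dd' => /addIr ->.
Qed.

(** The multipliers are sorted by their codeword, which vanishes off [W]; each value is taken with
    probability at most [p^-|W|]. *)
Lemma card_short_codeword (F : realType) m n p (G : 'I_m -> 'I_n -> bool)
    (u : {ffun 'I_m -> 'F_p}) (r : F) (W := nbC G (supp u)) : prime p ->
  #|[set h | lift_sq F (codeword G h u) < r ^+ 2]%SET|%:R <=
    #|short_in p W r|%:R / p%:R ^+ #|W| * #|{: {ffun 'I_m * 'I_n -> 'F_p}}|%:R :> F.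
Proof.
move=> pp; set S := [set h | _]%SET.
have pR0 : 0 < p%:R :> F by rewrite ltr0n prime_gt0.
rewrite mulrAC ler_pdivlMr ?exprn_gt0// -!natrX -!natrM ler_nat.
have SW h : h \in S -> codeword G h u \in short_in p W r.
  rewrite !inE => ->; rewrite andbT; apply/forallP => j; apply/implyP => jW.
  by rewrite codeword_supp.
have -> : #|S| = (\sum_(c in short_in p W r) #|[set h in S | codeword G h u == c]%SET|)%N.
  rewrite -sum1_card (partition_big (fun h => codeword G h u) (mem (short_in p W r))) //=.
  by apply: eq_bigr => c _; rewrite sum1dep_card.
rewrite big_distrl /= -sum_nat_const; apply: leq_sum => c _.
apply: leq_trans (card_codeword_eq G u c pp); rewrite leq_mul2r; apply/orP; right.
by apply: subset_leq_card; apply/fintype.subsetP => h; rewrite !inE => /andP[].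
Qed.

Lemma prob_unifE (F : realType) m n p (P : {ffun 'I_m * 'I_n -> 'F_p} -> Prop) :
  prob_unif F P = #|[set h | `[< P h >]]%SET|%:R / #|{: {ffun 'I_m * 'I_n -> 'F_p}}|%:R.
Proof.
rewrite /prob_unif; congr (_%:R / _); apply: eq_card => h.
by rewrite [RHS]inE -[RHS]asboolb.
Qed.

(** A union bound over [u != 0], grouped by support: at most [p^|T|] vectors have support [T]. *)
Lemma prob_short_codeword (F : realType) m n p (G : 'I_m -> 'I_n -> bool) (r : F)
    (P : {ffun 'I_m * 'I_n -> 'F_p} -> Prop) : prime p ->
  (forall h, (forall u, u != 0 -> r ^+ 2 <= lift_sq F (codeword G h u)) -> P h) ->
  1 - \sum_(T : {set 'I_m} | T != finset.set0) p%:R ^+ #|T| *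
     (#|short_in p (nbC G T) r|%:R / p%:R ^+ #|nbC G T|) <= prob_unif F P <= 1.
Proof.
move=> pp hP; rewrite prob_unifE.
set N := #|{: _}|; set A := [set h | _]%SET.
have N0 : 0 < N%:R :> F by rewrite ltr0n; apply/card_gt0P; exists 0.
have pR0 : 0 < p%:R :> F by rewrite ltr0n prime_gt0.
apply/andP; split; last first.
  by rewrite ler_pdivrMr// mul1r ler_nat max_card.
rewrite lerBlDr -lerBlDl.
have -> : 1 - #|A|%:R / N%:R = #|~: A|%:R / N%:R :> F.
  have NA : N = (#|A| + #|~: A|)%N by rewrite cardsC.
  by rewrite -{1}(divff (lt0r_neq0 N0)) -mulrBl {1}NA natrD addrAC subrr add0r.
pose f (T : {set 'I_m}) : F := #|short_in p (nbC G T) r|%:R / p%:R ^+ #|nbC G T|.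
have f0 T : 0 <= f T by rewrite divr_ge0// exprn_ge0// ltW.
apply: (@le_trans _ _ (\sum_(u : {ffun 'I_m -> 'F_p} | u != 0) f (supp u))).
  rewrite ler_pdivrMr// mulr_suml.
  apply: le_trans (ler_sum _ _) => [|u _]; last exact: card_short_codeword.
  rewrite -natr_sum ler_nat.
  apply: (@leq_trans #|\bigcup_(u : {ffun 'I_m -> 'F_p} | u != 0)
      [set h | lift_sq F (codeword G h u) < r ^+ 2]%SET|).
    apply: subset_leq_card; apply/fintype.subsetP => h; rewrite !inE => /asboolP hA.
    have [u u0 hu] : exists2 u, u != 0 & lift_sq F (codeword G h u) < r ^+ 2.
      apply: contra_notP hA => no; apply: hP => u u0; rewrite leNgt; apply/negP => hu.
      by apply: no; exists u.
    by apply/bigcupP; exists u => //; rewrite inE.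
  by apply: (big_ind2 (fun (B : {set _}) k => #|B| <= k)%N); rewrite ?cards0// => B k B' k' Bk Bk';
    rewrite (leq_trans (leq_card_setU _ _).1)// leq_add.
rewrite (partition_big (@supp m p) (fun T => T != finset.set0)) /=; last first.
  move=> u; apply: contraNneq => u0; apply/eqP/ffunP => i; rewrite ffunE; apply/eqP.
  by have := finset.in_set0 i; rewrite -u0 inE => /negbFE.
apply: ler_sum => T _; rewrite (eq_bigr (fun=> f T)); last by move=> u /andP[_ /eqP->].
rewrite sumr_const -[_ *+ _]mulr_natl ler_wpM2r// -natrX ler_nat.
have <- : #|pffun_on (0 : 'F_p) (mem T) predT| = (p ^ #|T|)%N.
  by rewrite card_pffun_on card_Fp.
apply: subset_leq_card; apply/fintype.subsetP => u; rewrite inE => /andP[_ /eqP uT].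
by apply/pffun_onP; split => //; apply/supportP => i; rewrite -uT inE negbK => /eqP.
Qed.

(** * Evaluation of the union bound *)

Lemma sum_exp_card (F : realType) m (x : F) : \sum_(T : {set 'I_m}) x ^+ #|T| = (1 + x) ^+ m.
Proof.
have -> : (1 + x) ^+ m = \prod_(i < m) (x + 1) by rewrite prodr_const card_ord addrC.
rewrite bigA_distr; apply: eq_bigr => T _.
by rewrite -big_mkcond /= prodr_const.
Qed.

(* By (L2), the variable nodes all of whose neighbours avoid [T] cannot be too
   many: a subset of them of the critical size would have more than [m / 2]
   neighbours, all outside [T]. *)
Lemma card_compl_nbC (F : realType) m n (G : 'I_m -> 'I_n -> bool) (R al : F) (T : {set 'I_m}) :
  R < 1 -> 1 <= al -> m%:R = n%:R * (1 - R) ->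
  (forall S : {set 'I_n}, (#|S|%:Z <= Num.ceil (n%:R * (1 - R) / (2 * al)))%R ->
    al * #|S|%:R <= #|nbV G S|%:R) ->
  n%:R * (1 - R) / 2 < #|T|%:R ->
  (n - #|nbC G T| <= m - #|T|)%N.
Proof.
move=> R1 al1 mn L2 mT.
have al0 : 0 < al by apply: lt_le_trans al1.
have cardCT k (A : {set 'I_k}) : #|~: A| = (k - #|A|)%N.
  by have := cardsC A; rewrite card_ord => /esym kE; rewrite [X in (X - _)%N]kE addKn.
have nbS (S : {set 'I_n}) : S \subset ~: nbC G T -> (#|nbV G S| <= m - #|T|)%N.
  move=> ST; rewrite -cardCT; apply/subset_leq_card/fintype.subsetP => i.
  rewrite !inE => /existsP[j /andP[jS Gij]]; apply/negP => iT.
  have := fintype.subsetP ST j jS; rewrite !inE => /existsPn/(_ i).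
  by rewrite iT Gij.
rewrite -cardCT; set S := ~: nbC G T.
(* Up to the critical size, (L2) and [1 <= al] give [|S| <= |N(S)| <= m - |T|]. *)
have [/L2 h|h] := leP (#|S|%:Z) (Num.ceil (n%:R * (1 - R) / (2 * al))).
  rewrite -(ler_nat F); apply: (@le_trans _ _ (al * #|S|%:R)).
    by rewrite ler_peMl.
  by apply: le_trans h _; rewrite ler_nat nbS.
pose k := `|Num.ceil (n%:R * (1 - R) / (2 * al))|%N.
have c0 : (0 <= Num.ceil (n%:R * (1 - R) / (2 * al)))%R.
  rewrite ceil_ge0 (@lt_le_trans _ _ 0) ?ltrN10// divr_ge0// mulr_ge0// ?subr_ge0 ltW//.
have kE : k%:Z = Num.ceil (n%:R * (1 - R) / (2 * al)) by rewrite /k gez0_abs.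
have kS : (k <= #|S|)%N by rewrite -lez_nat kE ltW.
pose S' := [set x in take k (enum S)]%SET.
have cS' : #|S'| = k.
  rewrite cardsE (card_uniqP _) ?take_uniq ?enum_uniq// size_take -cardE.
  by case: ltngtP kS.
have S'S : S' \subset S.
  by apply/fintype.subsetP => x; rewrite inE => /mem_take; rewrite mem_enum.
have := L2 S'; rewrite cS' kE lexx => /(_ isT) h1.
have h2 : n%:R * (1 - R) / 2 <= al * k%:R.
  have : n%:R * (1 - R) / (2 * al) <= k%:R.
    have -> : k%:R = (Num.ceil (n%:R * (1 - R) / (2 * al)))%:~R :> F by rewrite -kE.
    exact: ceil_ge.
  rewrite ler_pdivrMr ?mulr_gt0// ler_pdivrMr//.
  by have -> : al * k%:R * 2 = k%:R * (2 * al) by ring.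
have := nbS _ S'S; rewrite -(ler_nat F) natrB; last by rewrite -[leqRHS]card_ord max_card.
rewrite mn; lra.
Qed.

(* The three summands bound the ranges [|T| <= th m], [th m < |T| <= m / 2] and
   [m / 2 < |T|]; [P] stands for [p ^ R]. *)
Lemma sum_terms_le (F : realType) m n p (G : 'I_m -> 'I_n -> bool)
    (R B be th eta kappa theta C P r : F) :
  prime p -> (0 < n)%N -> 0 < R < 1 -> m%:R = n%:R * (1 - R) ->
  0 < B -> 0 < be -> 0 < th -> 0 < eta -> 0 < kappa -> 0 <= theta -> 0 <= C -> 1 <= P ->
  (forall T : {set 'I_m}, #|T|%:R <= th * n%:R * (1 - R) -> B * #|T|%:R <= #|nbC G T|%:R) ->
  (forall T : {set 'I_m}, #|T|%:R <= n%:R * (1 - R) / 2 -> be * #|T|%:R <= #|nbC G T|%:R) ->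
  (forall T : {set 'I_m}, n%:R * (1 - R) / 2 < #|T|%:R -> (n - #|nbC G T| <= m - #|T|)%N) ->
  0 < r -> r <= C * P * Num.sqrt n%:R ->
  n%:R <= eta ^+ 2 * r ^+ 2 -> kappa * P <= eta * r / Num.sqrt n%:R -> kappa * P <= p%:R ->
  (leb_vol (@open_ball0 F n (r * (1 + 2 * eta))) <= (theta ^+ n * p%:R ^+ n / p%:R ^+ m)%:E)%E ->
  let D := 2 * expR 2 * (1 + C) * P / p%:R in
  let x := p%:R * (D * Num.sqrt n%:R) `^ B in
  let y := p%:R * (D / Num.sqrt (be * th * (1 - R))) `^ be in
  D * Num.sqrt n%:R <= 1 -> D / Num.sqrt (be * th * (1 - R)) <= 1 -> y <= 1 ->
  \sum_(T : {set 'I_m} | T != finset.set0) p%:R ^+ #|T| *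
     (#|short_in p (nbC G T) r|%:R / p%:R ^+ #|nbC G T|) <=
  ((1 + x) ^+ m - 1) + (2 * y `^ th) ^+ m + theta ^+ n * (1 + (kappa * P)^-1) ^+ m.
Proof.
move=> pp n0 /andP[R0 R1] mn B0 be0 th0 e0 k0 theta0 C0 P1 hR1 hR2 hL2 r0 rC nr kr kp vol D x y.
move=> Dn Ds y1.
have pR0 : 0 < p%:R :> F by rewrite ltr0n prime_gt0.
have P0 : 0 < P by apply: lt_le_trans P1.
have R1' : 0 < 1 - R by rewrite subr_gt0.
have sn0 : 0 < Num.sqrt n%:R :> F by rewrite sqrtr_gt0 ltr0n.
have D0 : 0 < D.
  by rewrite /D divr_gt0// !mulr_gt0// ?expR_gt0// ltr_wpDr.
have g0 : 0 < be * th * (1 - R) by rewrite !mulr_gt0.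
have sg0 : 0 < Num.sqrt (be * th * (1 - R)) by rewrite sqrtr_gt0.
have x0 : 0 <= x by rewrite mulr_ge0// powR_ge0.
have y0 : 0 <= y by rewrite mulr_ge0// powR_ge0.
have kP0 : 0 < kappa * P by rewrite mulr_gt0.
pose term (T : {set 'I_m}) : F := p%:R ^+ #|T| *
     (#|short_in p (nbC G T) r|%:R / p%:R ^+ #|nbC G T|).
have chernoff (T : {set 'I_m}) b : (0 < #|nbC G T|)%N ->
    D * Num.sqrt n%:R / Num.sqrt #|nbC G T|%:R <= b ->
    term T <= p%:R ^+ #|T| * b ^+ #|nbC G T|.
  move=> w0 hb; rewrite ler_pM2l ?exprn_gt0//.
  set w := #|nbC G T| in w0 hb *.
  have sw0 : 0 < Num.sqrt w%:R :> F by rewrite sqrtr_gt0 ltr0n.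
  have swn : Num.sqrt w%:R <= Num.sqrt n%:R :> F.
    by rewrite ler_sqrt// ler_nat -[leqRHS]card_ord max_card.
  rewrite ler_pdivrMr ?exprn_gt0// -exprMn.
  apply: (le_trans (card_short_in_le (nbC G T) pp r0)); rewrite -/w.
  have base0 : 0 <= 2 * expR 2 * (1 + r / Num.sqrt w%:R) :> F.
    by rewrite !mulr_ge0 ?expR_ge0// addr_ge0// divr_ge0 ?ltW.
  have b0 : 0 <= b.
    by apply: le_trans hb; apply: divr_ge0 (ltW sw0); apply: mulr_ge0 (ltW D0) (ltW sn0).
  apply: lerXn2r; rewrite ?nnegrE// ?mulr_ge0 ?(ltW pR0)//.
  apply: (@le_trans _ _ (D * Num.sqrt n%:R / Num.sqrt w%:R * p%:R)); last by rewrite ler_pM2r.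
  have -> : D * Num.sqrt n%:R / Num.sqrt w%:R * p%:R =
     2 * expR 2 * ((1 + C) * P * (Num.sqrt n%:R / Num.sqrt w%:R)).
    by rewrite /D; field; rewrite !gt_eqF.
  rewrite ler_pM2l ?mulr_gt0 ?expR_gt0//.
  have h1 : 1 <= P * (Num.sqrt n%:R / Num.sqrt w%:R).
    by rewrite -[leLHS]mul1r ler_pM// ler_pdivlMr// mul1r.
  have h2 : r / Num.sqrt w%:R <= C * (P * (Num.sqrt n%:R / Num.sqrt w%:R)).
    by rewrite ler_pdivrMr// mulrA -[leRHS]mulrA divfK ?gt_eqF.
  rewrite -mulrA mulrDl mul1r; exact: lerD.
(* Each term is bounded by all three bounds together, so the sum need not be split by the size of
   [T]. *)
have term_le (T : {set 'I_m}) : T != finset.set0 ->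
    term T <= x ^+ #|T| + (y `^ th) ^+ m + theta ^+ n * (kappa * P)^-1 ^+ #|~: T|.
  rewrite -card_gt0 => T0.
  have z1 : 0 <= x ^+ #|T| by rewrite exprn_ge0.
  have z2 : 0 <= (y `^ th) ^+ m by rewrite exprn_ge0// powR_ge0.
  have z3 : 0 <= theta ^+ n * (kappa * P)^-1 ^+ #|~: T|.
    by rewrite mulr_ge0// exprn_ge0// invr_ge0 ltW.
  have T0R : 0 < #|T|%:R :> F by rewrite ltr0n.
  have [small|big] := leP (#|T|%:R : F) (n%:R * (1 - R) / 2); last first.
    apply: (@le_trans _ _ (theta ^+ n * (kappa * P)^-1 ^+ #|~: T|)); last by rewrite lerDr addr_ge0.
    set w := #|nbC G T|; set K := eta * r / Num.sqrt n%:R in kr.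
    have K0 : 0 < K by apply: lt_le_trans kr.
    have wn : (w <= n)%N by rewrite -[leqRHS]card_ord max_card.
    have tm : (#|T| <= m)%N by rewrite -[leqRHS]card_ord max_card.
    have tauE : #|~: T| = (m - #|T|)%N.
      by have := cardsC T; rewrite card_ord => /esym mE; rewrite [X in (X - _)%N]mE addKn.
    (* The volume comparison leaves [theta^n (p / K)^(n - w) / p^(m - |T|)]. As [p / (kappa P) >= 1]
       and [n - w <= m - |T|], each check node outside [T] contributes a factor [1 / (kappa P)]. *)
    have := le_trans (short_in_box_volume (nbC G T) pp n0 r0 e0 nr) vol.
    rewrite lee_fin -/K -/w -ler_pdivlMr ?exprn_gt0// => shK.
    rewrite /term -/w.
    apply: (@le_trans _ _ (p%:R ^+ #|T| *
        (theta ^+ n * p%:R ^+ n / p%:R ^+ m / K ^+ (n - w) / p%:R ^+ w))).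
      by rewrite ler_pM2l ?exprn_gt0// ler_pM2r ?invr_gt0 ?exprn_gt0.
    have -> : p%:R ^+ #|T| * (theta ^+ n * p%:R ^+ n / p%:R ^+ m / K ^+ (n - w) / p%:R ^+ w) =
        theta ^+ n * (p%:R / K) ^+ (n - w) / p%:R ^+ (m - #|T|).
      have -> : p%:R ^+ n = p%:R ^+ w * p%:R ^+ (n - w) :> F by rewrite -exprD subnKC.
      have -> : p%:R ^+ m = p%:R ^+ #|T| * p%:R ^+ (m - #|T|) :> F by rewrite -exprD subnKC.
      have alg (a b c e k l : F) : a != 0 -> b != 0 -> e != 0 -> k != 0 ->
        a * (l * (b * c) / (a * e) / k / b) = l * (c / k) / e.
        by move=> *; field; apply/and4P.
      by rewrite [in RHS]exprMn exprVn; apply: alg; rewrite expf_neq0 ?gt_eqF.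
    rewrite -mulrA ler_wpM2l ?exprn_ge0// tauE ler_pdivrMr ?exprn_gt0// -exprMn.
    rewrite [_^-1 * _]mulrC.
    apply: (@le_trans _ _ ((p%:R / (kappa * P)) ^+ (n - w))).
      apply: lerXn2r; rewrite ?nnegrE; [exact: divr_ge0 (ltW pR0) (ltW K0)|exact: divr_ge0 (ltW pR0) (ltW kP0)|].
      by rewrite ler_pM2l// lef_pV2 ?posrE.
    by apply: ler_weXn2l; rewrite ?hL2// ler_pdivlMr// mul1r.
  have w0 : (0 < #|nbC G T|)%N.
    by rewrite -(ltr_nat F); apply: lt_le_trans (hR2 _ small); rewrite mulr_gt0.
  have powX (a b : F) (k : nat) (t : nat) : 0 < a <= 1 -> b * t%:R <= k%:R ->
      p%:R ^+ t * a ^+ k <= (p%:R * a `^ b) ^+ t.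
    move=> /andP[a0 a1] bk; rewrite exprMn ler_pM2l ?exprn_gt0//.
    rewrite -(powR_mulrn k (ltW a0)) -(powR_mulrn t (powR_ge0 a b)) -powRrM.
    by apply: ger_powR; rewrite // a0.
  (* For tiny [T] the crude [|N(T)| >= 1] suffices in the Chernoff base, since (R1) makes the
     exponent large. Otherwise [|N(T)| >= be th m] is linear in [n], the base loses its factor
     [sqrt n], and [y <= 1] allows [|T|] to be replaced by [th m]. *)
  have [tiny|med] := leP (#|T|%:R : F) (th * n%:R * (1 - R)).
    apply: (@le_trans _ _ (x ^+ #|T|)); last by rewrite -addrA lerDl addr_ge0.
    apply: le_trans (chernoff T (D * Num.sqrt n%:R) w0 _) _.
      rewrite ler_pdivrMr ?sqrtr_gt0 ?ltr0n//; apply: ler_peMr.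
        exact: mulr_ge0 (ltW D0) (ltW sn0).
      by rewrite -[leLHS]sqrtr1 ler_wsqrtr// ler1n.
    by apply: powX; [rewrite mulr_gt0|exact: hR1].
  apply: (@le_trans _ _ ((y `^ th) ^+ m)); last by rewrite addrAC lerDr addr_ge0.
  apply: le_trans (chernoff T (D / Num.sqrt (be * th * (1 - R))) w0 _) _.
    rewrite -mulrA ler_pM2l// ler_pdivrMr ?sqrtr_gt0 ?ltr0n// mulrC ler_pdivlMr//.
    rewrite -sqrtrM ?ler0n// ler_wsqrtr//; apply: le_trans (hR2 _ small).
    have -> : n%:R * (be * th * (1 - R)) = be * (th * n%:R * (1 - R)) by ring.
    by rewrite ler_pM2l// ltW.
  apply: (@le_trans _ _ (y ^+ #|T|)).
    by apply: powX; [rewrite divr_gt0|exact: hR2].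
  have y_gt0 : 0 < y by rewrite mulr_gt0// powR_gt0// divr_gt0.
  rewrite -!powR_mulrn ?powR_ge0// -powRrM; apply: ger_powR; first by rewrite y_gt0.
  by rewrite mn mulrA ltW.
apply: (@le_trans _ _ (\sum_(T : {set 'I_m} | T != finset.set0)
   (x ^+ #|T| + (y `^ th) ^+ m + theta ^+ n * (kappa * P)^-1 ^+ #|~: T|))).
  by apply: ler_sum => T; exact: term_le.
(* The first and third sums are binomial, the third after passing to complements; the second counts
   at most [2^m] sets. *)
rewrite !big_split /= -mulr_sumr; apply: lerD; first apply: lerD.
- have -> : (1 + x) ^+ m - 1 = \sum_(T : {set 'I_m} | T != finset.set0) x ^+ #|T|.
    by rewrite -sum_exp_card (bigD1 finset.set0)//= cards0 expr0 addrAC subrr add0r.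
  exact: lexx.
- rewrite exprMn [2 ^+ m](_ : _ = \sum_(T : {set 'I_m}) 1 ^+ #|T|); last by rewrite sum_exp_card.
  rewrite mulr_suml [leRHS](bigD1 finset.set0)//= ler_wpDl ?mulr_ge0 ?exprn_ge0 ?powR_ge0//.
  by apply: ler_sum => T _; rewrite expr1n mul1r.
- rewrite ler_wpM2l ?exprn_ge0// -sum_exp_card [leRHS](reindex_inj (@finset.setC_inj _)) /=.
  by rewrite [leRHS](bigD1 finset.set0)//= ler_wpDl// exprn_ge0// invr_ge0 ltW.
Qed.

(** With [a = m x], [(1 + x)^m <= exp a], and [exp a (1 - a) <= 1] gives [exp a - 1 <= 2 a] for
    [a <= 1/2]. *)
Lemma exprD1B1_le (F : realType) m (x : F) : 0 <= x -> m%:R * x <= 2^-1 ->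
  (1 + x) ^+ m - 1 <= 2 * (m%:R * x).
Proof.
move=> x0 mx; set a := m%:R * x in mx *.
have a0 : 0 <= a by rewrite mulr_ge0.
apply: (@le_trans _ _ (expR a - 1)).
  rewrite lerB// /a expRM_natl lerXn2r ?nnegrE ?expR_ge0 ?expR_ge1Dx//.
  exact: addr_ge0.
have h : expR a * (1 - a) <= 1.
  rewrite -[leRHS](@expRxMexpNx_1 _ a) ler_pM2l ?expR_gt0//; exact: expR_ge1Dx.
have := expR_ge0 a; nra.
Qed.

(* The constants [8 e^2] and [2] of [leb_vol_ball1] yield
   [P sqrt n / (16 e^2) <= r <= 2 P sqrt n] for the radius [r] of short vectors. *)
Lemma prob_packing_ge (F : realType) m n p (G : 'I_m -> 'I_n -> bool)
    (R al B be th d delta theta' : F) (P := (p%:R : F) `^ R) (eta := d / 4)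
    (kappa := eta / (16 * expR 2)) (D := 2 * expR 2 * (1 + 2) * P / p%:R)
    (x := p%:R * (D * Num.sqrt n%:R) `^ B)
    (y := p%:R * (D / Num.sqrt (be * th * (1 - R))) `^ be) :
  prime p -> (0 < n)%N -> 0 < R < 1 -> m%:R = n%:R * (1 - R) ->
  1 <= al -> 0 < B -> 0 < be -> 0 < th -> 0 < d <= 2^-1 -> d <= delta ->
  (forall S : {set 'I_n}, (#|S|%:Z <= Num.ceil (n%:R * (1 - R) / (2 * al)))%R ->
    al * #|S|%:R <= #|nbV G S|%:R) ->
  (forall T : {set 'I_m}, #|T|%:R <= th * n%:R * (1 - R) -> B * #|T|%:R <= #|nbC G T|%:R) ->
  (forall T : {set 'I_m}, #|T|%:R <= n%:R * (1 - R) / 2 -> be * #|T|%:R <= #|nbC G T|%:R) ->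
  1 <= kappa * P -> D * Num.sqrt n%:R <= 1 -> D / Num.sqrt (be * th * (1 - R)) <= 1 ->
  y <= 1 -> 2 * y `^ th <= 1 -> n%:R * x <= 2^-1 ->
  (1 - d / 2) * (1 + (kappa * P)^-1) <= theta' ->
  1 - (2 * (n%:R * x) + 2 * y `^ th + theta' ^+ n) <=
  prob_unif F (fun h : {ffun 'I_m * 'I_n -> 'F_p} =>
     1 / 2 - delta <= r_pack (@dual_lattice F _ (LDA_lattice G h)) /
                  r_eff (@dual_lattice F _ (LDA_lattice G h))) <= 1.
Proof.
move=> pp n0 R01 mn al1 B0 be0 th0 /andP[d0 d2] d_delta L2 R1 R2 kP Dn Ds y1 yth nx th'.
have /andP[R_gt0 R_lt1] := R01.
have pR0 : 0 < p%:R :> F by rewrite ltr0n prime_gt0.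
have p1 : 1 <= p%:R :> F by rewrite ler1n prime_gt0.
have P0 : 0 < P by rewrite powR_gt0.
have P1 : 1 <= P by rewrite /P -[leLHS](powRr0 p%:R) ler_powR// ltW.
have Pp : P <= p%:R by rewrite /P -[leRHS](powRr1 (ltW pR0)) ler_powR// ltW.
have e0 : 0 < eta by rewrite divr_gt0.
have E0 : 0 < expR 2 :> F by rewrite expR_gt0.
have E1 : 1 <= expR 2 :> F by rewrite -expR0 ler_expR.
have k0 : 0 < kappa by rewrite divr_gt0// mulr_gt0.
have sn0 : 0 < Num.sqrt n%:R :> F by rewrite sqrtr_gt0 ltr0n.
have sn2 : Num.sqrt n%:R ^+ 2 = n%:R :> F by rewrite sqr_sqrtr.
have [v vE /andP[vlo vhi]] := leb_vol_ball1 F n0.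
have v0 : 0 < v by apply: lt_le_trans vlo; rewrite exprn_gt0// invr_gt0 mulr_gt0.
have mltn : (m <= n)%N by rewrite -(ler_nat F) mn ler_piMr// gerBl ltW.
have m0 : (0 < m)%N by rewrite -(ltr_nat F) mn mulr_gt0 ?ltr0n// subr_gt0.
have Pn : P ^+ n = p%:R ^+ n / p%:R ^+ m.
  have -> : p%:R ^+ n / p%:R ^+ m = p%:R ^+ (n - m) :> F.
    by rewrite -{1}(subnK mltn) exprD mulfK// expf_neq0 ?gt_eqF.
  rewrite -!powR_mulrn ?powR_ge0 ?ltW// /P -powRrM natrB// mn; congr (_ `^ _); ring.
pose rho := (p%:R ^- m / v) `^ (n%:R^-1).
have rho0 : 0 < rho by rewrite powR_gt0// divr_gt0// invr_gt0 exprn_gt0.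
have rhoE : rho ^+ n * v = p%:R ^- m.
  rewrite -powR_mulrn ?powR_ge0// -powRrM mulVf ?pnatr_eq0 -?lt0n//.
  by rewrite powRr1 ?divr_ge0 ?invr_ge0 ?exprn_ge0 ?ltW// divfK ?gt_eqF.
have prhoE : (p%:R * rho) ^+ n * v = P ^+ n by rewrite exprMn -mulrA rhoE Pn.
have rho_le : p%:R * rho <= 2 * P * Num.sqrt n%:R.
  have -> : 2 * P * Num.sqrt n%:R = P * (2 * Num.sqrt n%:R) by ring.
  rewrite -(@ler_pXn2r _ n)//; last 2 first.
  - by rewrite nnegrE ltW// mulr_gt0.
  - by rewrite nnegrE ltW// !mulr_gt0.
  rewrite [leRHS]exprMn -ler_pdivrMr ?exprn_gt0 ?mulr_gt0// -prhoE -exprVn.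
  by rewrite ler_pM2l// exprn_gt0// mulr_gt0.
have rho_ge : P * Num.sqrt n%:R / (8 * expR 2) <= p%:R * rho.
  have -> : P * Num.sqrt n%:R / (8 * expR 2) = P / (8 * expR 2 / Num.sqrt n%:R).
    by field; rewrite !gt_eqF.
  have q0 : 0 < 8 * expR 2 / Num.sqrt n%:R :> F by rewrite divr_gt0// mulr_gt0.
  rewrite -(@ler_pXn2r _ n)//; last 2 first.
  - by rewrite nnegrE ltW// divr_gt0.
  - by rewrite nnegrE ltW// mulr_gt0.
  rewrite expr_div_n ler_pdivrMr ?exprn_gt0// -prhoE.
  by rewrite ler_pM2l// exprn_gt0// mulr_gt0.
pose r := (1 - d) * (p%:R * rho).
have d1 : 0 < 1 - d by rewrite subr_gt0 (le_lt_trans d2)// invf_lt1 ?ltr1n.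
have r0 : 0 < r by rewrite !mulr_gt0.
have rC : r <= 2 * P * Num.sqrt n%:R.
  by apply: le_trans rho_le; rewrite ler_piMl ?mulr_ge0 ?(ltW rho0) ?(ltW pR0)// gerBl ltW.
have r_ge : P * Num.sqrt n%:R / (16 * expR 2) <= r.
  have -> : P * Num.sqrt n%:R / (16 * expR 2) = 2^-1 * (P * Num.sqrt n%:R / (8 * expR 2)).
    by field; rewrite gt_eqF.
  apply: ler_pM => //; last by lra.
  by rewrite divr_ge0// ?mulr_ge0 ?(ltW P0) ?(ltW E0).
have kr : kappa * P <= eta * r / Num.sqrt n%:R.
  rewrite ler_pdivlMr//.
  have -> : kappa * P * Num.sqrt n%:R = eta * (P * Num.sqrt n%:R / (16 * expR 2)).
    by rewrite /kappa; field; rewrite gt_eqF.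
  by rewrite ler_pM2l.
have nr : n%:R <= eta ^+ 2 * r ^+ 2.
  rewrite -sn2 -exprMn; apply: lerXn2r; rewrite ?nnegrE.
  - exact: ltW.
  - exact: mulr_ge0 (ltW e0) (ltW r0).
  - by rewrite -[leLHS]mul1r -ler_pdivlMr//; exact: le_trans kP kr.
(* The hypothesis [D sqrt n <= 1] reads [6 e^2 P sqrt n <= p], and [r <= 2 P sqrt n]. *)
have rp : r <= p%:R.
  apply: le_trans rC _; have Ps0 : 0 < P * Num.sqrt n%:R by rewrite mulr_gt0.
  have : 2 * expR 2 * (1 + 2) * (P * Num.sqrt n%:R) <= p%:R.
    have -> : 2 * expR 2 * (1 + 2) * (P * Num.sqrt n%:R) = D * Num.sqrt n%:R * p%:R.
      by rewrite /D; field; rewrite gt_eqF.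
    by rewrite ler_piMl// ltW.
  have : P * Num.sqrt n%:R <= expR 2 * (P * Num.sqrt n%:R) by rewrite ler_peMl// ltW.
  lra.
have kp : kappa * P <= p%:R.
  apply: le_trans Pp; rewrite ler_piMl ?(ltW P0)// /kappa ler_pdivrMr ?mulr_gt0// mul1r /eta.
  lra.
(* The enlarged ball has radius [theta p rho]; with [eta = d / 4] the shrinking by [1 - d] outweighs
   the thickening. *)
pose theta := (1 - d) * (1 + 2 * eta).
have theta_le : theta <= 1 - d / 2 by have := sqr_ge0 d; rewrite /theta /eta; lra.
have theta0 : 0 <= theta by apply: mulr_ge0 (ltW d1) _; rewrite addr_ge0// mulr_ge0// ltW.
have vol : (leb_vol (@open_ball0 F n (r * (1 + 2 * eta))) <=
    (theta ^+ n * p%:R ^+ n / p%:R ^+ m)%:E)%E.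
  have re0 : 0 < r * (1 + 2 * eta) by rewrite mulr_gt0// addr_gt0// mulr_gt0.
  rewrite leb_vol_ball// vE -EFinM lee_fin.
  have -> : (r * (1 + 2 * eta)) ^+ n * v = theta ^+ n * P ^+ n.
    rewrite -prhoE [RHS]mulrA -exprMn; congr (_ ^+ n * _); rewrite /r /theta; ring.
  by rewrite Pn mulrA.
have compl T := card_compl_nbC R_lt1 al1 mn L2 (T := T).
have := sum_terms_le pp n0 R01 mn B0 be0 th0 e0 k0 theta0 (ler0n _ 2) P1 R1 R2 compl
  r0 rC nr kr kp vol Dn Ds y1.
set Sum := \sum_(T | _) _ => SumP.
have := @prob_short_codeword F m n p G r (fun h =>
     1 / 2 - delta <= r_pack (@dual_lattice F _ (LDA_lattice G h)) /
                  r_eff (@dual_lattice F _ (LDA_lattice G h))) pp.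
move=> /(_ _)/andP[].
  move=> h hu; have rp' : 0 < r <= p%:R by rewrite r0.
  apply: le_trans (r_pack_r_eff_ge pp n0 rp' rho0 vE v0 rhoE hu).
  have -> : r / (2 * p%:R) / rho = (1 - d) / 2.
    by rewrite /r; field; rewrite !gt_eqF.
  lra.
move=> lo ->; rewrite andbT; apply: le_trans lo; rewrite lerB//.
apply: le_trans SumP _; apply: lerD; first apply: lerD.
- have x0 : 0 <= x by rewrite mulr_ge0 ?powR_ge0.
  have mx : m%:R * x <= n%:R * x by rewrite ler_wpM2r// ler_nat.
  apply: (le_trans (exprD1B1_le x0 (le_trans mx nx))).
  by rewrite ler_pM2l.
- by apply: ler_iXnr; rewrite // mulr_ge0 ?powR_ge0.
- have s0 : 0 <= (kappa * P)^-1 by rewrite invr_ge0 mulr_ge0 ?(ltW k0) ?(ltW P0).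
  apply: (@le_trans _ _ ((theta * (1 + (kappa * P)^-1)) ^+ n)).
    by rewrite [leRHS]exprMn ler_wpM2l ?exprn_ge0// ler_weXn2l// lerDl.
  have t1 : 0 <= theta * (1 + (kappa * P)^-1) by rewrite mulr_ge0// addr_ge0.
  have t2 : theta * (1 + (kappa * P)^-1) <= theta'.
    by apply: le_trans th'; rewrite ler_wpM2r// addr_ge0.
  by apply: lerXn2r; rewrite // nnegrE// (le_trans t1).
Qed.

(** * Asymptotics *)

Lemma near_powRN (F : realType) (nn : nat -> nat) (c e : F) : 0 < c -> 0 < e ->
  (forall N : nat, exists K : nat, forall k : nat, (K <= k)%N -> (N <= nn k)%N) ->
  \forall k \near \oo, (nn k)%:R `^ (- c) <= e.
Proof.
move=> c0 e0 nnoo.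
have [K hK] := nnoo (Num.truncn (e^-1 `^ c^-1)).+1.
exists K => // k /= Kk.
have lt_n : e^-1 `^ c^-1 < (nn k)%:R.
  by apply: lt_le_trans (truncnS_gt _) _; rewrite ler_nat hK.
have n0 : 0 < (nn k)%:R :> F by apply: le_lt_trans lt_n; rewrite powR_ge0.
rewrite powRN -[leRHS]invrK lef_pV2 ?posrE ?powR_gt0 ?invr_gt0//.
have ei0 : 0 <= e^-1 by rewrite invr_ge0 ltW.
have -> : e^-1 = (e^-1 `^ c^-1) `^ c by rewrite -powRrM mulVf ?gt_eqF// powRr1.
by apply: ge0_ler_powR; rewrite ?nnegrE ?powR_ge0 ?(ltW c0) ?(ltW n0) ?(ltW lt_n).
Qed.

Lemma near_cst_powRN (F : realType) (nn : nat -> nat) (a c e : F) : 0 < c -> 0 < e -> 0 <= a ->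
  (forall N : nat, exists K : nat, forall k : nat, (K <= k)%N -> (N <= nn k)%N) ->
  \forall k \near \oo, a * (nn k)%:R `^ (- c) <= e.
Proof.
move=> c0 e0 a0 nnoo.
have a1 : 0 < a + 1 by rewrite ltr_wpDl.
have := near_powRN c0 (divr_gt0 e0 a1) nnoo; apply: filterS => k.
rewrite ler_pdivlMr// mulrC; apply: le_trans.
by rewrite ler_wpM2r ?powR_ge0// lerDl.
Qed.

Lemma near_expr (F : realType) (nn : nat -> nat) (t e : F) : 0 <= t < 1 -> 0 < e ->
  (forall N : nat, exists K : nat, forall k : nat, (K <= k)%N -> (N <= nn k)%N) ->
  \forall k \near \oo, t ^+ nn k <= e.
Proof.
move=> /andP[t0 t1] e0 nnoo.
have /cvgrPdist_le/(_ e e0)[N _ hN] : (fun n => t ^+ n) @ \oo --> (0 : F).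
  by apply: cvg_expr; rewrite ger0_norm.
have [K hK] := nnoo N; exists K => // k /= /hK Nk.
by have := hN _ Nk; rewrite /= sub0r normrN ger0_norm ?exprn_ge0.
Qed.

Lemma powRN_le (F : realType) (n p : nat) (lam a : F) : (0 < n)%N -> 0 <= a ->
  n%:R `^ lam <= p%:R -> p%:R `^ (- a) <= n%:R `^ (- (lam * a)).
Proof.
move=> n0 a0 np; have nl0 : 0 < n%:R `^ lam :> F by rewrite powR_gt0 ?ltr0n.
have p0 : 0 < p%:R :> F by apply: lt_le_trans np.
rewrite !powRN powRrM lef_pV2 ?posrE; [|exact: powR_gt0|exact: powR_gt0].
by apply: ge0_ler_powR; rewrite ?nnegrE ?(ltW nl0) ?(ltW p0).
Qed.

(** Since [D = c p^(R - 1)], each quantity is a negative power of [p] times a power of [n], and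
    [p >= n^lam] turns it into a single power of [n]. *)
Lemma powR_bounds (F : realType) n p (R B be lam c : F) (P := (p%:R : F) `^ R)
    (D := c * P / p%:R) : (0 < n)%N -> (0 < p)%N -> 0 < R < 1 -> 0 < c ->
  0 < B -> 0 < be -> 1 < be * (1 - R) -> 1 < B * (1 - R) -> n%:R `^ lam <= p%:R ->
  [/\ P^-1 <= n%:R `^ (- (lam * R)),
      D <= c * n%:R `^ (- (lam * (1 - R))),
      D * Num.sqrt n%:R <= c * n%:R `^ (- (lam * (1 - R) - 2^-1)),
      forall g, 0 < g -> p%:R * (D / g) `^ be <=
        (c / g) `^ be * n%:R `^ (- (lam * (be * (1 - R) - 1))) &
      n%:R * (p%:R * (D * Num.sqrt n%:R) `^ B) <=
        c `^ B * n%:R `^ (- (lam * (B * (1 - R) - 1) - 1 - B / 2))].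
Proof.
move=> n0 p0 /andP[R0 R1] c0 B0 be0 be1 B1 np.
have nR0 : 0 < n%:R :> F by rewrite ltr0n.
have pR0 : 0 < p%:R :> F by rewrite ltr0n.
have nN : n%:R != 0 :> F by rewrite gt_eqF.
have pN : p%:R != 0 :> F by rewrite gt_eqF.
have DE : D = c * p%:R `^ (- (1 - R)).
  rewrite /D -mulrA; congr (_ * _).
  by rewrite opprB powRD ?pN ?implybT// powR_inv1 ?ltW.
have sE : Num.sqrt n%:R = n%:R `^ 2^-1 :> F by rewrite powR12_sqrt// ltW.
have d1 : D <= c * n%:R `^ (- (lam * (1 - R))).
  by rewrite DE ler_pM2l// powRN_le// subr_ge0 ltW.
have pD a g : 0 < g -> 0 <= a -> p%:R * (c * p%:R `^ (- (1 - R)) / g) `^ a =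
    (c / g) `^ a * p%:R `^ (- (a * (1 - R) - 1)).
  move=> g0 a0; have cg0 : 0 <= c / g by rewrite divr_ge0 ?ltW.
  rewrite [c * _ / g]mulrAC (powRM _ cg0 (powR_ge0 _ _)).
  rewrite -powRrM mulrCA; congr (_ * _).
  rewrite -{1}(powRr1 (ltW pR0)) -powRD ?pN ?implybT//; congr (_ `^ _); ring.
split.
- by rewrite /P -powRN powRN_le// ltW.
- exact: d1.
- have -> : - (lam * (1 - R) - 2^-1) = - (lam * (1 - R)) + 2^-1 by ring.
  by rewrite powRD ?nN ?implybT// -sE mulrA ler_wpM2r// sqrtr_ge0.
- move=> g g0; rewrite DE pD ?(ltW be0)//; apply: ler_wpM2l; first exact: powR_ge0.
  by apply: powRN_le; rewrite // subr_ge0 ltW.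
- have -> : D * Num.sqrt n%:R = c * p%:R `^ (- (1 - R)) / n%:R `^ (- 2^-1).
    by rewrite DE sE [n%:R `^ (- _)]powRN invrK.
  rewrite pD ?powR_gt0 ?(ltW B0)//.
  rewrite [n%:R `^ (- 2^-1)]powRN invrK powRM ?powR_ge0 ?(ltW c0)// -powRrM.
  rewrite mulrCA -mulrA ler_pM2l ?powR_gt0//.
  have -> : - (lam * (B * (1 - R) - 1) - 1 - B / 2) =
     (1 + 2^-1 * B) + - (lam * (B * (1 - R) - 1)) by field.
  rewrite powRD ?nN ?implybT// powRD ?nN ?implybT// powRr1 ?(ltW nR0)//.
  rewrite mulrA [_ `^ _ * n%:R]mulrC ler_pM2l ?mulr_gt0 ?powR_gt0//.
  by apply: powRN_le; rewrite // subr_ge0 ltW.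
Qed.

Unset Implicit Arguments. Set Strict Implicit.

Theorem theorem4 (F : realType) (R : F) (dV dC : nat)
  (al A be B eps th lam : F)
  (nn mm pp : nat -> nat) (G : forall k, 'I_(mm k) -> 'I_(nn k) -> bool) :
  0 < R < 1 ->
  (0 < dV)%N -> (dV < dC)%N -> dV%:R / dC%:R = 1 - R :> F ->
  1 <= al -> al < A ->
  1 / (1 - R) < be -> be < Num.min (2 / (1 - R)) B ->
  0 < eps -> eps < (1 - R) / A ->
  0 < th -> th < 1 / (B * (1 - R)) ->
  degree_condition (dV%:R) R al A be B eps th ->
  (forall N : nat, exists K : nat, forall k : nat, (K <= k)%N -> (N <= nn k)%N) ->
  (forall k, (mm k)%:R = (nn k)%:R * (1 - R)) ->
  (forall k, biregular (G k) dV dC) ->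
  (forall k, good (G k) R al A be B eps th) ->
  Num.max (1 / (2 * (1 - R))) ((2 * B + 3 / 2) / (B * (1 - R) - 1)) < lam ->
  (forall k, smallest_prime_ge (pp k) ((nn k)%:R `^ lam)) ->
  forall delta : F, 0 < delta ->
    (fun k => prob_unif F (fun h : {ffun 'I_(mm k) * 'I_(nn k) -> 'F_(pp k)} =>
        1 / 2 - delta <=
          r_pack (@dual_lattice F _ (LDA_lattice (G k) h)) /
          r_eff (@dual_lattice F _ (LDA_lattice (G k) h))))
      @ \oo --> (1 : F).
Proof.
move=> /[dup] R01 /andP[R0 R1] _ _ _ al1 _ be1 be_lt _ _ th0 _ _ nnoo mn _ Ggood lam_gt pprime delta delta0.
have R1' : 0 < 1 - R by rewrite subr_gt0.
have beR : 1 < be * (1 - R) by rewrite -ltr_pdivrMr.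
have be0 : 0 < be by apply: lt_trans be1; rewrite divr_gt0.
have beB : be < B by move: be_lt; rewrite lt_min => /andP[].
have B0 : 0 < B by apply: lt_trans beB.
have BR : 1 < B * (1 - R) by apply: lt_trans beR _; rewrite ltr_pM2r.
move: lam_gt; rewrite gt_max => /andP[lam1 lam2].
have BR1 : 0 < B * (1 - R) - 1 by rewrite subr_gt0.
have {}lam1 : 2^-1 < lam * (1 - R).
  by move: lam1; rewrite ltr_pdivrMr ?mulr_gt0//; lra.
have {}lam2 : 2 * B + 3 / 2 < lam * (B * (1 - R) - 1) by rewrite -ltr_pdivrMr.
have lam0 : 0 < lam.
  by rewrite -(pmulr_lgt0 _ R1'); apply: lt_trans lam1; rewrite invr_gt0.
pose d := Num.min delta 2^-1.
have d0 : 0 < d by rewrite lt_min delta0 invr_gt0 /=.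
have d2 : d <= 2^-1 by rewrite ge_min lexx orbT.
have d_delta : d <= delta by rewrite ge_min lexx.
pose kappa := d / 4 / (16 * expR 2).
have kappa0 : 0 < kappa by rewrite !divr_gt0// mulr_gt0 ?expR_gt0.
pose c : F := 2 * expR 2 * (1 + 2).
have c0 : 0 < c by rewrite !mulr_gt0 ?expR_gt0.
pose g := Num.sqrt (be * th * (1 - R)).
have g0 : 0 < g by rewrite sqrtr_gt0 !mulr_gt0.
apply/cvgrPdist_le => e e0.
(* Each of the three error terms gets a third of [e]: [ex] bounds [n x], which enters doubled, and
   [e'] is the value of [y] at which [2 y^th] reaches [e3], capped at 1. *)
pose e3 := Num.min 1 (e / 3); have e3_gt0 : 0 < e3 by rewrite lt_min ltr01 divr_gt0.
pose e' := Num.min 1 ((e3 / 2) `^ th^-1).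
have e'0 : 0 < e' by rewrite lt_min ltr01 powR_gt0 ?divr_gt0.
pose ex := Num.min 2^-1 (e / 6); have ex0 : 0 < ex by rewrite lt_min invr_gt0 divr_gt0 ?ltr0n.
have n_gt0 : \forall k \near \oo, (0 < nn k)%N.
  by have [K hK] := nnoo 1%N; exists K => // k /= /hK.
(* All the exponents are negative: in [h3] by the first lower bound on [lam], in [h4] by
   [be (1 - R) > 1], and in [h5] by the second bound, since [2 B + 3/2 > 1 + B/2]. *)
have h1 : \forall k \near \oo, kappa^-1 * (nn k)%:R `^ (- (lam * R)) <= d / 4.
  apply: near_cst_powRN nnoo; rewrite ?divr_gt0 ?mulr_gt0 ?invr_ge0 ?(ltW kappa0)//.
have h2 : \forall k \near \oo, c / g * (nn k)%:R `^ (- (lam * (1 - R))) <= 1.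
  by apply: near_cst_powRN nnoo; rewrite ?mulr_gt0 ?divr_ge0 ?(ltW c0) ?(ltW g0).
have h3 : \forall k \near \oo, c * (nn k)%:R `^ (- (lam * (1 - R) - 2^-1)) <= 1.
  by apply: near_cst_powRN nnoo; rewrite ?subr_gt0 ?(ltW c0).
have h4 : \forall k \near \oo, (c / g) `^ be * (nn k)%:R `^ (- (lam * (be * (1 - R) - 1))) <= e'.
  by apply: near_cst_powRN nnoo; rewrite ?mulr_gt0 ?subr_gt0 ?powR_ge0.
have h5 : \forall k \near \oo,
    c `^ B * (nn k)%:R `^ (- (lam * (B * (1 - R) - 1) - 1 - B / 2)) <= ex.
  by apply: near_cst_powRN nnoo; rewrite ?powR_ge0//; lra.
have h6 : \forall k \near \oo, (1 - d / 4) ^+ nn k <= e / 3.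
  by apply: near_expr nnoo; rewrite ?divr_gt0//; lra.
near=> k.
have n0 : (0 < nn k)%N by near: k.
have [prime_p np _] := pprime k.
have [_ L2 G1 G2] := Ggood k.
have [b1 b2 b3 b4 b5] := powR_bounds n0 (prime_gt0 prime_p) R01 c0 B0 be0 beR BR np.
have {}b4 := b4 g g0.
set P := (pp k)%:R `^ R in b1 b2 b3 b4 b5.
have P0 : 0 < P by rewrite powR_gt0// ltr0n prime_gt0.
set D := c * P / (pp k)%:R in b2 b3 b4 b5.
have kP : (kappa * P)^-1 <= d / 4.
  rewrite invfM; apply: (@le_trans _ _ (kappa^-1 * (nn k)%:R `^ (- (lam * R)))).
    by rewrite ler_pM2l ?invr_gt0.
  by near: k.
have kP1 : 1 <= kappa * P.
  by rewrite -[leRHS]invrK invf_ge1 ?invr_gt0 ?mulr_gt0//; lra.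
have Dn : D * Num.sqrt (nn k)%:R <= 1 by apply: le_trans b3 _; near: k.
have Dg : D / g <= 1.
  apply: (@le_trans _ _ (c / g * (nn k)%:R `^ (- (lam * (1 - R))))); last by near: k.
  by rewrite [leRHS]mulrAC ler_pM2r ?invr_gt0.
have ye : (pp k)%:R * (D / g) `^ be <= e' by apply: le_trans b4 _; near: k.
have y1 : (pp k)%:R * (D / g) `^ be <= 1 by apply: le_trans ye _; rewrite ge_min lexx.
have yth : 2 * ((pp k)%:R * (D / g) `^ be) `^ th <= e3.
  have -> : e3 = 2 * ((e3 / 2) `^ th^-1) `^ th.
    by rewrite -powRrM mulVf ?gt_eqF// powRr1 ?divr_ge0 ?(ltW e3_gt0)// mulrC divfK.
  rewrite ler_pM2l//; apply: ge0_ler_powR; rewrite ?nnegrE ?powR_ge0 ?(ltW th0)//.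
    by rewrite mulr_ge0// powR_ge0.
  by apply: le_trans ye _; rewrite ge_min lexx orbT.
have nx : (nn k)%:R * ((pp k)%:R * (D * Num.sqrt (nn k)%:R) `^ B) <= ex.
  by apply: le_trans b5 _; near: k.
have yth1 : e3 <= 1 by rewrite ge_min lexx.
have yth2 : e3 <= e / 3 by rewrite ge_min lexx orbT.
have nx1 : ex <= 2^-1 by rewrite ge_min lexx.
have nx2 : ex <= e / 6 by rewrite ge_min lexx orbT.
(* The factor [1 + (kappa P)^-1] tends to 1, so half of the gain [d / 2] survives. *)
have th' : (1 - d / 2) * (1 + (kappa * P)^-1) <= 1 - d / 4.
  apply: (@le_trans _ _ ((1 - d / 2) * (1 + d / 4))); first by rewrite ler_wpM2l ?lerD2l//; lra.
  have := sqr_ge0 d; lra.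
have d02 : 0 < d <= 2^-1 by rewrite d0.
have := prob_packing_ge prime_p n0 R01 (mn k) al1 B0 be0 th0 d02 d_delta L2 G1 G2 kP1 Dn Dg y1
  (le_trans yth yth1) (le_trans nx nx1) th'.
have h6k : (1 - d / 4) ^+ nn k <= e / 3 by near: k.
move=> /andP[lo hi]; rewrite ger0_norm ?subr_ge0// lerBlDr -lerBlDl.
apply: le_trans lo; rewrite lerB//; lra.
Unshelve. all: by end_near.
Qed.
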